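(* Let $P$ be a cubical $d$-polytope with no simple vertices. Then the graph $G(P)$ of $P$ is $(d+1)$-connected.
   Context: A cube is any polytope combinatorially equivalent to a standard cube (i.e. its face lattice is isomorphic to the face lattice of a standard cube). A cubical $d$-polytope is a $d$-dimensional (convex) polytope all of whose facets are cubes. The graph $G(P)$ of a polytope $P$ is the graph formed by its vertices and edges (1-dimensional faces). A vertex of a $d$-polytope is simple if it has degree exactly $d$ in $G(P)$, and nonsimple otherwise. A graph is $k$-connected if it has more than $k$ vertices and removing any set of fewer than $k$ vertices leaves a connected graph. *)

(* Defs.v *)
From mathcomp Require Import all_boot all_order all_algebra.
From mathcomp Require Import boolp classical_sets functions cardinality reals.
From mathcomp Require Import convex.

Set Implicit Arguments.
Unset Strict Implicit.
Unset Printing Implicit Defensive.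

Import Order.TTheory GRing.Theory Num.Theory.

Local Open Scope classical_set_scope.
Local Open Scope card_scope.
Local Open Scope ring_scope.

Section Graphs.
Variable T : eqType.

(* The relation [adj] is only meaningful between vertices. *)
Record graph := Graph { verts : set T; adj : T -> T -> Prop }.

Definition degree_eq (G : graph) (v : T) (k : nat) : Prop :=
  [set w | verts G w /\ adj G v w] #= `I_k.

Definition remove_verts (G : graph) (S : set T) : graph :=
  Graph (verts G `\` S) (adj G).

Definition connected_graph (G : graph) : Prop :=
  forall u v, verts G u -> verts G v ->
  exists p : seq T, [/\ path (fun x y => `[< adj G x y >]) u p,
    {in p, forall x, verts G x} & last u p = v].

Definition k_connected (k : nat) (G : graph) : Prop :=
  `I_k.+1 #<= verts G /\
  forall (S : set T) (m : nat), S `<=` verts G -> S #= `I_m -> (m < k)%N ->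
    connected_graph (remove_verts G S).

End Graphs.

Section Polytopes.
Variables (R : realType) (n : nat).
Local Notation V := 'rV[R]_n.
Implicit Types (X P F : set V).

Definition affine_hull X : set V :=
  [set x | exists (m : nat) (c : 'I_m -> R) (p : 'I_m -> V),
    [/\ forall i, X (p i), \sum_(i < m) c i = 1
      & x = \sum_(i < m) c i *: p i]].

(* The affine hull of X is a translate of a linear subspace of dimension k.
   The empty set (of dimension -1) has no dimension in this sense. *)
Definition has_dim X (k : nat) : Prop :=
  exists (x : V) (U : {vspace V}),
    affine_hull X = [set y | y - x \in U] /\ \dim U = k.

Definition polytope P : Prop :=
  exists A : set V, finite_set A /\ P = smallest (@convex_set R V) A.

(* The functional a may vanish, so that set0 and P itself are faces of P. *)
Definition face P F : Prop :=
  exists (a : {scalar V}) (b : R),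
    (forall x, P x -> a x <= b) /\ F = P `&` [set x | a x = b].

Definition facet (d : nat) P F : Prop :=
  face P F /\ exists2 k : nat, has_dim F k & k.+1 = d.

Definition vertex P (v : V) : Prop := face P [set v].

Definition edge P F : Prop := face P F /\ has_dim F 1.

(* Two distinct vertices are adjacent when some edge contains both, i.e. when
   they are the two endpoints of that edge. *)
Definition polytope_graph P : graph V :=
  Graph (vertex P)
    (fun u v => [/\ vertex P u, vertex P v, u <> v
      & exists E, [/\ edge P E, E u & E v]]).

Definition simple_vertex (d : nat) P (v : V) : Prop :=
  vertex P v /\ degree_eq (polytope_graph P) v d.

Definition standard_cube : set V := [set x | forall i, 0 <= x 0 i <= 1].

End Polytopes.

(* Isomorphism of the face lattices, ordered by inclusion. *)
Definition combinatorially_equivalent (R : realType) (m n : nat)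
    (P : set 'rV[R]_m) (Q : set 'rV[R]_n) : Prop :=
  exists f : set 'rV[R]_m -> set 'rV[R]_n,
    set_bij (face P) (face Q) f /\
    forall F G, face P F -> face P G -> (F `<=` G <-> f F `<=` f G).

Definition cube (R : realType) (n : nat) (P : set 'rV[R]_n) : Prop :=
  polytope P /\
  exists k : nat, combinatorially_equivalent P (@standard_cube R k).

Definition cubical_polytope (R : realType) (n d : nat) (P : set 'rV[R]_n)
    : Prop :=
  [/\ polytope P, has_dim P d & forall F, facet d P F -> cube F].

(* Main.v *)
Require Import Defs.
From HB Require Import structures.
From mathcomp Require Import all_boot all_order all_algebra.
From mathcomp Require Import boolp.
From mathcomp Require Import ring lra zify.

(** Balinski's argument.  Let S be a set of at most d vertices whose removal
    disconnects the graph, and let f be an affine functional vanishing on S.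
    Every vertex with f > 0 can climb along edges to the face where f is
    maximal, and similarly for f < 0, so the hyperplane f = 0 contains no vertex
    outside S and separates the rest.  Hence S consists of d affinely
    independent vertices spanning that hyperplane.  Tilting it around S \ {s}
    yields a facet F_s with F_s /\ S = S \ {s}.

    For d >= 4, F_s is a cube of dimension d - 1 in which every t in S \ {s} is
    cut off from S \ {s, t} by the face F_s /\ F_t; so t differs from the other
    points of S \ {s} in a coordinate of its own, and S \ {s} is the set of
    neighbours in F_s of a vertex w.  This w lies on all the F_t, so it does not
    depend on s, and P is contained in the simplicial cone with apex w spanned
    by S: the vertex w is simple.

    For d <= 3 a simple vertex always exists.  For d = 3, fix a functional that
    is injective on the vertices.  Each quadrangle has two vertices that are
    neither its top nor its bottom, whereas a vertex is in such an intermediate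
    position on at most two facets, and the top one on none.  So there are fewer
    facets than vertices, and some vertex lies on fewer than four facets. *)

Set Implicit Arguments.
Unset Strict Implicit.
Unset Printing Implicit Defensive.

Import Order.TTheory GRing.Theory Num.Theory.
Local Open Scope ring_scope.

Lemma finite_argmax (R : realFieldType) (I : finType) (A : {set I})
    (F : I -> R) (i0 : I) :
  i0 \in A -> exists2 i, i \in A & forall j, j \in A -> F j <= F i.
Proof.
move=> i0A; case: (@Order.TotalTheory.arg_maxP _ R I i0 (mem A) F i0A) => i iA Hi.
by exists i.
Qed.

(** * Linear functionals as column vectors *)

Definition dot (R : comNzRingType) m (x : 'rV[R]_m) (c : 'cV[R]_m) : R :=
  (x *m c) 0 0.

Section Dot.
Variables (R : comNzRingType) (m : nat).
Implicit Types (x y : 'rV[R]_m) (c d : 'cV[R]_m) (k : R).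

Lemma dotDl x y c : dot (x + y) c = dot x c + dot y c.
Proof. by rewrite /dot mulmxDl mxE. Qed.
Lemma dotDr x c d : dot x (c + d) = dot x c + dot x d.
Proof. by rewrite /dot mulmxDr mxE. Qed.
Lemma dotNl x c : dot (- x) c = - dot x c.
Proof. by rewrite /dot mulNmx mxE. Qed.
Lemma dotNr x c : dot x (- c) = - dot x c.
Proof. by rewrite /dot mulmxN mxE. Qed.
Lemma dotBl x y c : dot (x - y) c = dot x c - dot y c.
Proof. by rewrite dotDl dotNl. Qed.
Lemma dotBr x c d : dot x (c - d) = dot x c - dot x d.
Proof. by rewrite dotDr dotNr. Qed.
Lemma dotZl k x c : dot (k *: x) c = k * dot x c.
Proof. by rewrite /dot -scalemxAl mxE. Qed.
Lemma dotZr k x c : dot x (k *: c) = k * dot x c.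
Proof. by rewrite /dot -scalemxAr mxE. Qed.
Lemma dot0l c : dot 0 c = 0.
Proof. by rewrite /dot mul0mx mxE. Qed.
Lemma dot0r x : dot x 0 = 0.
Proof. by rewrite /dot mulmx0 mxE. Qed.
Lemma dot_suml (J : Type) (r : seq J) (Q : pred J) (F : J -> 'rV[R]_m) c :
  dot (\sum_(j <- r | Q j) F j) c = \sum_(j <- r | Q j) dot (F j) c.
Proof. by rewrite /dot mulmx_suml summxE. Qed.

Lemma dot_delta x j : dot x (delta_mx j 0) = x 0 j.
Proof.
rewrite /dot mxE (bigD1 j) //= mxE !eqxx mulr1 big1 ?addr0 // => i ij.
by rewrite mxE (negPf ij) mulr0.
Qed.

End Dot.

Definition dotE := (dotDl, dotDr, dotNl, dotNr, dotZl, dotZr, dot0l, dot0r).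

Lemma submx_separation (F : fieldType) m n (M : 'M[F]_(n, m)) (x : 'rV_m) :
  ~~ (x <= M)%MS -> exists2 c : 'cV[F]_m, M *m c = 0 & dot x c != 0.
Proof.
move=> xM; have: x *m cokermx M != 0 by rewrite -submxE.
case/matrix0Pn => i [j]; rewrite ord1 => xj.
exists (col j (cokermx M)); first by rewrite colE mulmxA mulmx_coker mul0mx.
by rewrite /dot colE mulmxA -colE mxE.
Qed.

(** * Faces of a point configuration *)

(* The points are given in homogeneous coordinates, with e constantly 1 on them:
   linear functionals stand for affine ones, and rk is the dimension plus one.
   An exposed set is the set of points on a face. *)
Section Configuration.
Variables (R : realFieldType) (m : nat) (I : finType).
Variables (p : I -> 'rV[R]_m) (e : 'cV[R]_m).
Hypothesis pe : forall i, dot (p i) e = 1.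
Implicit Types (A B S : {set I}) (i j k l : I) (b c f g h : 'cV[R]_m).

Definition exposed A := exists2 c : 'cV[R]_m,
  (forall i, 0 <= dot (p i) c) & A = [set i | dot (p i) c == 0].

Definition span_of A : 'M[R]_m := (\sum_(i in A) <<p i>>)%MS.
Definition rk A := \rank (span_of A).

Lemma mem_span A i : i \in A -> (p i <= span_of A)%MS.
Proof.
move=> iA; apply: submx_trans (sumsmx_sup i iA (submx_refl _)).
by rewrite genmxE.
Qed.

Lemma span_subP A n (M : 'M[R]_(n, m)) :
  (forall i, i \in A -> (p i <= M)%MS) -> (span_of A <= M)%MS.
Proof. by move=> AM; apply/sumsmx_subP => i iA; rewrite genmxE AM. Qed.

Lemma span_subset A B : A \subset B -> (span_of A <= span_of B)%MS.
Proof. by move=> /subsetP AB; apply: span_subP => i /AB /mem_span. Qed.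

Lemma rk_subset A B : A \subset B -> (rk A <= rk B)%N.
Proof. by move=> AB; rewrite mxrankS ?span_subset. Qed.

Lemma rk_card A : (rk A <= #|A|)%N.
Proof.
rewrite /rk /span_of -sum1_card.
apply: (big_ind2 (fun (M : 'M[R]_m) n => \rank M <= n)%N) => //.
- by rewrite mxrank0.
- move=> M1 n1 M2 n2 H1 H2; apply: leq_trans (leq_add H1 H2).
  exact: leq_of_leqif (mxrank_adds_leqif _ _).
- by move=> i _; rewrite genmxE rank_leq_row.
Qed.

Lemma span_zero A c i : (forall j, j \in A -> dot (p j) c = 0) ->
  (p i <= span_of A)%MS -> dot (p i) c = 0.
Proof.
move=> Ac iA; have: (span_of A <= kermx c)%MS.
  by apply: span_subP => j /Ac jc; apply/sub_kermxP/matrixP => a z; rewrite !ord1 [RHS]mxE.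
by move/(submx_trans iA)/sub_kermxP => pc; rewrite /dot pc mxE.
Qed.

Lemma span_separation A x : ~~ (x <= span_of A)%MS ->
  exists2 c, (forall j, j \in A -> dot (p j) c = 0) & dot x c != 0.
Proof.
move=> /submx_separation[c Ac xc]; exists c => // j /mem_span /submxP[D ->].
by rewrite /dot -mulmxA Ac mulmx0 mxE.
Qed.

Lemma rk_lt_out A B : (rk A < rk B)%N -> exists2 i, i \in B & ~~ (p i <= span_of A)%MS.
Proof.
move=> AB; apply/exists_inP; apply: contraLR AB => /exists_inPn BA.
by rewrite -leqNgt mxrankS // span_subP // => i /BA; rewrite negbK.
Qed.

Lemma rk_proper A B c : A \subset B ->
  (forall i, i \in A -> dot (p i) c = 0) ->
  (exists2 i, i \in B & dot (p i) c != 0) -> (rk A < rk B)%N.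
Proof.
move=> AB Ac [i iB ic]; rewrite /rk ltn_neqAle rk_subset // andbT.
apply: contra ic => /eqP rAB; apply/eqP; apply: (span_zero Ac).
have: (span_of A == span_of B)%MS by rewrite -(geq_leqif (mxrank_leqif_eq (span_subset AB))) rAB.
by move/eqmxP=> ->; rewrite mem_span.
Qed.

Lemma exposed_setT : exposed [set: I].
Proof. by exists 0 => [i|]; [rewrite dot0r | apply/setP => i; rewrite !inE dot0r eqxx]. Qed.

(** A face of a face is a face: adding to [c] a large multiple of the functional [a] exposing [A]
    makes it positive off [A] and does not change it on [A]. *)
Lemma exposedS A B c : exposed A -> (forall i, i \in A -> 0 <= dot (p i) c) ->
  B = [set i in A | dot (p i) c == 0] -> exposed B.
Proof.
move=> [a a0 ->] Ac ->.
pose mu := \sum_(i | dot (p i) a != 0) (`|dot (p i) c| + 1) / dot (p i) a.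
have mu_gt i : dot (p i) a != 0 -> 0 < dot (p i) (c + mu *: a).
  move=> ai; have ai0 : 0 < dot (p i) a by rewrite lt_def ai a0.
  have : (`|dot (p i) c| + 1) / dot (p i) a <= mu.
    rewrite /mu (bigD1 i) //= lerDl sumr_ge0 // => j _.
    by rewrite divr_ge0 ?addr_ge0 ?ler01.
  rewrite ler_pdivrMr // !dotE.
  have := lerNnormlW (lexx (`|dot (p i) c|)); lra.
have mu_eq i : dot (p i) a = 0 -> dot (p i) (c + mu *: a) = dot (p i) c.
  by move=> ai; rewrite !dotE ai mulr0 addr0.
exists (c + mu *: a) => [i|].
  have [ai|ai] := eqVneq (dot (p i) a) 0; last exact/ltW/mu_gt.
  by rewrite mu_eq // Ac // inE ai.
apply/setP=> i; rewrite !inE; have [ai|ai] := eqVneq (dot (p i) a) 0.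
  by rewrite mu_eq.
by rewrite (gt_eqF (mu_gt i ai)).
Qed.

Lemma exposedI A B : exposed A -> exposed B -> exposed (A :&: B).
Proof.
move=> eA [b b0 ->]; apply: (exposedS (c := b) eA) => [i _|]; first exact: b0.
by apply/setP => i; rewrite !inE.
Qed.

(** The supporting hyperplane [b = 0] is rotated about its intersection with [h = 0] until it meets
    a further point of [A]. The slope [rho] is the largest quotient [h / b] over the points where
    [b] is nonzero. *)
Lemma tilt A b h : exposed A ->
  (forall l, l \in A -> 0 <= dot (p l) b) ->
  (forall l, l \in A -> dot (p l) b = 0 -> dot (p l) h <= 0) ->
  (exists2 j, j \in A & dot (p j) b != 0) ->
  exists rho, [/\ exposed [set l in A | rho * dot (p l) b == dot (p l) h],
    exists2 j, j \in A & dot (p j) b != 0 /\ rho * dot (p j) b = dot (p j) h &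
    forall l, l \in A -> dot (p l) h <= rho * dot (p l) b].
Proof.
move=> eA b0 bh [j0 j0A bj0].
have j0B : j0 \in [set j in A | dot (p j) b != 0] by rewrite inE j0A.
have [j] := finite_argmax (fun j => dot (p j) h / dot (p j) b) j0B.
rewrite inE => /andP[jA bj] Hj.
have le l : l \in A -> dot (p l) h <= dot (p j) h / dot (p j) b * dot (p l) b.
  move=> lA; have [bl|bl] := eqVneq (dot (p l) b) 0; first by rewrite bl mulr0 bh.
  by rewrite -ler_pdivrMr ?lt_def ?bl ?b0 // Hj // inE lA.
exists (dot (p j) h / dot (p j) b); split => //; last by exists j => //; rewrite divfK.
apply: (exposedS (c := (dot (p j) h / dot (p j) b) *: b - h) eA) => [i iA|].
  by rewrite !dotE subr_ge0 le.
by apply/setP => i; rewrite !inE !dotE subr_eq0.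
Qed.

Hypothesis vertexI : forall i, exposed [set i].

Lemma vertex_functional i : exists b, [/\ dot (p i) b = 0,
  forall j, 0 <= dot (p j) b & forall j, j != i -> 0 < dot (p j) b].
Proof.
have [b b0 /setP ib] := vertexI i; exists b; split=> // [|j ji].
  by have := ib i; rewrite !inE eqxx => /esym/eqP.
by rewrite lt_def b0 andbT; have := ib j; rewrite !inE (negPf ji) => <-.
Qed.

Lemma point_inj : injective p.
Proof.
move=> i j pij; have [b [bi _ bpos]] := vertex_functional i.
by apply/esym/eqP/negPn/negP => /bpos; rewrite -pij bi ltxx.
Qed.

Definition adj_in i j := (i != j) && `[< exposed [set i; j] >].

Lemma adj_in_sym : symmetric adj_in.
Proof. by move=> i j; rewrite /adj_in eq_sym setUC. Qed.

(** Induction on the size of [A]: while [A] has a third point, tilting the functional of the vertex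
    [i] yields a smaller face that still contains [i] and another point. *)
Lemma nbr_in_face A i j : exposed A -> i \in A -> j \in A -> j != i ->
  exists2 k, k \in A & adj_in i k.
Proof.
have [n] := ubnP #|A|; elim: n => // n IH in A j * => /ltnSE cA eA iA jA ji.
have [Aij|] := boolP (A \subset [set i; j]).
  exists j => //; rewrite /adj_in eq_sym ji; apply/asboolP.
  suff -> : [set i; j] = A by [].
  apply/eqP; rewrite eqEsubset Aij andbT; apply/subsetP => x.
  by rewrite !inE => /orP[] /eqP ->.
case/subsetPn => k kA; rewrite !inE negb_or => /andP[ki kj].
have [b [bi b0 bpos]] := vertex_functional i.
have [bj bk] := (bpos _ ji, bpos _ ki).
(* The direction from [p i] to [p x], scaled so that [b] is 1 on it: a point of the vertex figure at
   [i]. *)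
pose u x := (dot (p x) b)^-1 *: (p x - p i).
(* Otherwise [j] and [k] lie on one ray from [i]; the functional of the vertex [j] puts [j] farther
   out than [k], and that of [k] says the opposite. *)
have ujk : u j != u k.
  apply/eqP => /(congr1 (fun x => (dot (p j) b * dot (p k) b) *: x)).
  rewrite /u !scalerA mulrAC mulfV ?gt_eqF // mul1r -mulrA mulfV ?gt_eqF // mulr1 => E.
  have [c [cj c0 cpos]] := vertex_functional j.
  have [c' [ck c0' cpos']] := vertex_functional k.
  have ij : i != j by rewrite eq_sym.
  have ci := cpos _ ij; have ck' : 0 < dot (p k) c by rewrite cpos.
  have c'i : 0 < dot (p i) c' by rewrite cpos' // eq_sym.
  have c'j : 0 < dot (p j) c' by rewrite cpos' // eq_sym.
  have /eqP := congr1 (fun x => dot x c) E; have /eqP := congr1 (fun x => dot x c') E.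
  rewrite !dotE ck cj => /eqP E1 /eqP E2.
  have : 0 < dot (p i) c * (dot (p j) b - dot (p k) b).
    rewrite (_ : _ * _ = dot (p j) b * dot (p k) c) ?mulr_gt0 //; lra.
  have : 0 < dot (p i) c' * (dot (p k) b - dot (p j) b).
    rewrite (_ : _ * _ = dot (p k) b * dot (p j) c') ?mulr_gt0 //; lra.
  by rewrite !pmulr_rgt0 // !subr_gt0 => /lt_trans H /H; rewrite ltxx.
have [x [y /eqP xy]] : exists x y, (u j - u k) x y != 0.
  by apply/matrix0Pn; rewrite subr_eq0.
rewrite ord1 in xy.
(* A coordinate in which [u j] and [u k] differ, shifted to vanish at [i]. It is not constant on the
   vertex figure, so the tilted face is proper. *)
pose h := delta_mx y 0 - (p i 0 y) *: e.
have [] := @tilt A b h eA.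
- by move=> l _; apply: b0.
- move=> l _; have [->|/bpos /gt_eqF/eqP//] := eqVneq l i.
  by rewrite !dotE dot_delta pe mulr1 subrr.
- by exists j => //; rewrite gt_eqF.
move=> rho [eB [j' j'A [bj' j'B]] _].
have hE l : dot (p l) h = (p l - p i) 0 y.
  by rewrite !dotE dot_delta pe mulr1 !mxE.
set B := [set l in A | _] in eB.
have iB : i \in B by rewrite inE iA bi mulr0 hE subrr mxE eqxx.
have BA : B \subset A by apply/subsetP => z; rewrite inE => /andP[].
have properBA : B \proper A.
  rewrite properEneq BA andbT; apply: contra_notN xy => /eqP AB.
  have ux z : z \in A -> z != i -> u z 0 y = rho.
    rewrite -AB inE hE => /andP[_ /eqP E] zi.
    by rewrite /u mxE -E mulrC mulfK // gt_eqF // bpos.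
  by rewrite mxE [X in _ + X]mxE !ux ?subrr.
have [|||k0 k0B ak0] := IH B j' _ eB iB.
- by rewrite (leq_trans (proper_card properBA)).
- by rewrite inE j'A; apply/eqP.
- by apply: contraNneq bj' => ->; rewrite bi.
by exists k0 => //; apply: (subsetP BA).
Qed.

(** A pivot of the simplex method: as [j] is higher than [i], tilting towards [g] has slope
    [rho > 0]. On the face reached, [g] exceeds its value at [i] by [rho * b], so every neighbour of
    [i] in it is higher. *)
Lemma nbr_above A g i j : exposed A -> i \in A -> j \in A ->
  dot (p i) g < dot (p j) g ->
  exists k, [/\ k \in A, adj_in i k & dot (p i) g < dot (p k) g].
Proof.
move=> eA iA jA gij; have [b [bi b0 bpos]] := vertex_functional i.
have ji : j != i by apply: contraTneq gij => ->; rewrite ltxx.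
pose h := g - dot (p i) g *: e.
have hE l : dot (p l) h = dot (p l) g - dot (p i) g by rewrite !dotE pe mulr1.
have [] := @tilt A b h eA.
- by move=> l _; apply: b0.
- move=> l _; have [->|/bpos /gt_eqF/eqP//] := eqVneq l i.
  by rewrite hE subrr.
- by exists j => //; rewrite gt_eqF ?bpos.
move=> rho [eB [j' j'A [bj' j'B]] rhole].
have rho0 : 0 < rho.
  have := rhole j jA; rewrite hE => H; have bj := bpos _ ji.
  by rewrite -(pmulr_lgt0 _ bj); apply: lt_le_trans H; rewrite subr_gt0.
set B := [set l in A | _] in eB.
have [|||k kB ik] := @nbr_in_face B i j' eB.
- by rewrite inE iA bi hE mulr0 subrr eqxx.
- by rewrite inE j'A j'B eqxx.
- by apply: contraNneq bj' => ->; rewrite bi.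
move: kB; rewrite inE => /andP[kA /eqP kE].
exists k; split=> //; rewrite -subr_gt0 -hE -kE mulr_gt0 // bpos //.
by move: ik => /andP[]; rewrite eq_sym.
Qed.

Definition adj_within A i j := [&& adj_in i j, i \in A & j \in A].

Lemma adj_within_sym A : connect_sym (adj_within A).
Proof.
by apply: sym_connect_sym => i j; rewrite /adj_within adj_in_sym (andbC (i \in A)).
Qed.

Lemma adj_within_subset A B : A \subset B ->
  subrel (connect (adj_within A)) (connect (adj_within B)).
Proof.
move=> /subsetP AB; apply: connect_sub => i j /and3P[ij iA jA].
by apply: connect1; rewrite /adj_within ij !AB.
Qed.

(** Descent along edges for a functional whose minimum is attained at [j] only; the number of
    strictly lower points decreases. *)
Lemma face_connected A i j : exposed A -> i \in A -> j \in A ->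
  connect (adj_within A) i j.
Proof.
move=> eA + jA; have [b [bj b0 bpos]] := vertex_functional j.
have [n] := ubnP #|[set l | dot (p l) b < dot (p i) b]|.
elim: n => // n IH in i * => /ltnSE ci iA.
have [->//|ij] := eqVneq i j.
have [|k [kA ik]] := @nbr_above A (- b) i j eA iA jA.
  by rewrite !dotE bj oppr0 oppr_lt0 bpos.
rewrite !dotE ltrN2 => bki; apply: (connect_trans (y := k)).
  by apply: connect1; rewrite /adj_within ik iA kA.
apply: IH => //; apply: leq_trans ci; apply: proper_card; apply/properP; split.
  by apply/subsetP => l; rewrite !inE => /lt_trans; apply.
by exists k; rewrite !inE ?ltxx.
Qed.

(** Climbing keeps [f] positive, hence avoids [S], and ends in the face [T] where [f] is maximal,
    which is connected and also misses [S]. *)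
Lemma upper_connected S f i j : (forall s, s \in S -> dot (p s) f <= 0) ->
  0 < dot (p i) f -> 0 < dot (p j) f -> connect (adj_within (~: S)) i j.
Proof.
move=> fS fi fj.
have [t _ tmax] := finite_argmax (fun l => dot (p l) f) (in_setT i).
pose T := [set l | dot (p l) f == dot (p t) f].
have eT : exposed T.
  apply: (exposedS (c := dot (p t) f *: e - f) exposed_setT) => [l _|].
    by rewrite !dotE pe mulr1 subr_ge0 tmax.
  by apply/setP => l; rewrite !inE !dotE pe mulr1 subr_eq0 eq_sym.
have notS l : 0 < dot (p l) f -> l \in ~: S.
  by rewrite inE ltNge; apply: contra => /fS.
have climb l : 0 < dot (p l) f -> connect (adj_within (~: S)) l t.
  have [n] := ubnP #|[set k | dot (p l) f < dot (p k) f]|.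
  elim: n => // n IH in l * => /ltnSE cl fl.
  have [lT|lT] := boolP (l \in T).
    apply: (@adj_within_subset T); last by apply: face_connected; rewrite // inE.
    apply/subsetP => x; rewrite inE => /eqP xt; apply: notS; rewrite xt.
    by apply: lt_le_trans fl (tmax _ _).
  have [|k [_ lk flk]] := @nbr_above _ f l t exposed_setT (in_setT _) (in_setT _).
    by rewrite lt_neqAle tmax // andbT; rewrite inE in lT.
  have fk := lt_trans fl flk.
  apply: (connect_trans (y := k)); first by apply: connect1; rewrite /adj_within lk !notS.
  apply: IH => //; apply: leq_trans cl; apply: proper_card; apply/properP; split.
    by apply/subsetP => x; rewrite !inE => /(lt_trans flk).
  by exists k; rewrite !inE ?ltxx.
by apply: (connect_trans (climb i fi)); rewrite adj_within_sym climb.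
Qed.

Lemma lower_connected S f i j : (forall s, s \in S -> 0 <= dot (p s) f) ->
  dot (p i) f < 0 -> dot (p j) f < 0 -> connect (adj_within (~: S)) i j.
Proof.
move=> fS fi fj; apply: (@upper_connected S (- f)); rewrite ?dotNr ?oppr_gt0 //.
by move=> s /fS; rewrite dotNr oppr_le0.
Qed.

(** A point reachable from all points outside [S] contradicts the separation of [u] and [v]. An
    empty side of the hyperplane [f = 0] or a link between the two sides yields such a hub, and a
    point outside [S] on the hyperplane would be such a link. *)
Lemma separating_functional S f u v :
  u \notin S -> v \notin S -> ~~ connect (adj_within (~: S)) u v ->
  (forall s, s \in S -> dot (p s) f = 0) -> (exists i, dot (p i) f != 0) ->
  [/\ exists i, 0 < dot (p i) f, exists j, dot (p j) f < 0,
      forall i j, 0 < dot (p i) f -> dot (p j) f < 0 ->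
        ~~ connect (adj_within (~: S)) i j
    & forall i, dot (p i) f = 0 -> i \in S].
Proof.
move=> uS vS uv fS fn0.
have fS0 s : s \in S -> dot (p s) f <= 0 by move/fS ->.
have fS1 s : s \in S -> 0 <= dot (p s) f by move/fS ->.
have up i x : i \notin S -> dot (p i) f = 0 -> 0 < dot (p x) f ->
    connect (adj_within (~: S)) i x.
  move=> iS fi fx.
  have [|k [_ ik]] := @nbr_above _ f i x exposed_setT (in_setT _) (in_setT _).
    by rewrite fi.
  rewrite fi => fk; apply: connect_trans (upper_connected fS0 fk fx).
  apply: connect1; rewrite /adj_within ik !inE iS; apply: contraL fk => /fS0.
  by rewrite leNgt.
have down i x : i \notin S -> dot (p i) f = 0 -> dot (p x) f < 0 ->
    connect (adj_within (~: S)) i x.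
  move=> iS fi fx.
  have [|k [_ ik]] := @nbr_above _ (- f) i x exposed_setT (in_setT _) (in_setT _).
    by rewrite !dotNr fi ltrN2.
  rewrite !dotNr fi ltrN2 => fk; apply: connect_trans (lower_connected fS1 fk fx).
  apply: connect1; rewrite /adj_within ik !inE iS; apply: contraL fk => /fS1.
  by rewrite leNgt.
have hub x : (forall i, i \notin S -> connect (adj_within (~: S)) i x) -> False.
  move=> H; move/negP: uv; apply.
  by apply: connect_trans (H _ uS) _; rewrite adj_within_sym H.
have [[x fx]|/forallNP nopos] := pselect (exists i, 0 < dot (p i) f); last first.
  exfalso; have [x fx] := fn0; have {}fx : dot (p x) f < 0.
    by rewrite lt_neqAle fx leNgt; apply/negP/nopos.
  apply: (hub x) => i iS; have [fi|fi|fi] := ltgtP (dot (p i) f) 0.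
  - exact: (lower_connected fS1).
  - by case: (nopos _ fi).
  - exact: down.
have [[y fy]|/forallNP noneg] := pselect (exists i, dot (p i) f < 0); last first.
  exfalso; apply: (hub x) => i iS; have [fi|fi|fi] := ltgtP (dot (p i) f) 0.
  - by case: (noneg _ fi).
  - exact: (upper_connected fS0).
  - exact: up.
have sep i j : 0 < dot (p i) f -> dot (p j) f < 0 ->
    ~~ connect (adj_within (~: S)) i j.
  move=> fi fj; apply/negP => ij; apply: (hub i) => k kS.
  have [fk|fk|fk] := ltgtP (dot (p k) f) 0.
  - by apply: connect_trans (lower_connected fS1 fk fj) _; rewrite adj_within_sym.
  - exact: (upper_connected fS0).
  - exact: up.
split=> //; [by exists x | by exists y |].
move=> i fi; apply/negPn/negP => iS; have /negP := sep x y fx fy; apply.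
by apply: connect_trans (down i y iS fi fy); rewrite adj_within_sym up.
Qed.

End Configuration.

(** * Facets around a separator *)

Section Facets.
Variables (R : realFieldType) (m : nat) (I : finType).
Variables (p : I -> 'rV[R]_m) (e : 'cV[R]_m).
Hypothesis pe : forall i, dot (p i) e = 1.
Hypothesis vertexI : forall i, exposed p [set i].
Variable d : nat.
Hypothesis rkT : rk p [set: I] = d.+1.
Implicit Types (A B S : {set I}) (i j k l : I) (b c f g h : 'cV[R]_m).

Local Notation exposed := (exposed p).
Local Notation rk := (rk p).
Local Notation span_of := (span_of p).
Local Notation adj_in := (adj_in p).
Local Notation linked S := (connect (adj_within p (~: S))).

Lemma rk_gt0 A i : i \in A -> (0 < rk A)%N.
Proof.
move=> iA; apply: leq_trans (mxrankS (mem_span p iA)).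
rewrite lt0n mxrank_eq0; apply: contra_eq_neq (pe i) => ->.
by rewrite dot0l eq_sym oner_neq0.
Qed.

Lemma exposed_rk_proper A B : exposed A -> A \proper B -> (rk A < rk B)%N.
Proof.
move=> [c _ AE] /properP[AB [i iB iA]]; apply: (rk_proper (c := c)) => //.
  by move=> j; rewrite AE inE => /eqP.
by exists i => //; move: iA; rewrite AE inE.
Qed.

Lemma span_coef A (x : 'rV_m) : (x <= span_of A)%MS ->
  exists mu : I -> R, x = \sum_(j in A) mu j *: p j.
Proof.
case/sub_sumsmxP => u ->.
suff /choice[mu Hmu] : forall j, exists k : R, u j *m <<p j>>%MS = k *: p j.
  by exists mu; apply: eq_bigr => j _.
move=> j; apply/sub_rVP; apply: submx_trans (submxMl _ _) _.
by rewrite genmxE.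
Qed.

Definition nbrs i := [set j | adj_in i j].

(** With fewer than [d] neighbours, some functional vanishes at [i] and at all of them but is
    positive, up to sign, at another point; [nbr_above] then gives a neighbour where it is
    positive. *)
Lemma nbrs_card_ge i : (d <= #|nbrs i|)%N.
Proof.
rewrite leqNgt; apply/negP => small.
have : (rk (i |: nbrs i) < rk [set: I])%N.
  rewrite rkT ltnS (leq_trans (rk_card _ _)) // cardsU1.
  by case: (_ \notin _); rewrite ?add1n // ltnW.
case/rk_lt_out => j _ /span_separation[c c0 cj].
have c0i : dot (p i) c = 0 by apply: c0; rewrite !inE eqxx.
wlog cj0 : c c0 cj c0i / 0 < dot (p j) c.
  move=> W; case/lt_total/orP: (cj) => cj0; last exact: (W c).
  apply: (W (- c)); rewrite ?dotNr ?oppr_eq0 ?c0i ?oppr0 ?oppr_gt0 // => k kA.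
  by rewrite dotNr c0 ?oppr0.
have [|k [_ ik]] := nbr_above pe vertexI (exposed_setT p) (in_setT i) (in_setT j) (g := c).
  by rewrite c0i.
by rewrite c0i c0 ?ltxx // !inE ik orbT.
Qed.

(** The rank is full because a nontrivial functional vanishing on [S] has no further zeros among the
    points. The facet missing [s] is found by rotating [f = 0] about [S \ {s}]: with [lam] zero on
    [S \ {s}] and 1 at [s], it is exposed by [a = lam + kap * f]. *)
Lemma separator_facets S u v : (#|S| <= d)%N -> u \notin S -> v \notin S ->
  ~~ linked S u v ->
  (forall i, i \notin S -> rk (i |: S) = d.+1) /\
  forall s, s \in S -> exists a, [/\ forall i, 0 <= dot (p i) a,
    forall t, t \in S -> t != s -> dot (p t) a = 0, dot (p s) a = 1
    & rk [set i | dot (p i) a == 0] = d].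
Proof.
move=> cS uS vS uv.
have rkS i : i \notin S -> rk (i |: S) = d.+1.
  move=> iS; apply/eqP; rewrite eqn_leq -{1}rkT rk_subset ?subsetT //=.
  rewrite ltnNge; apply/negP => small.
  have : (rk (i |: S) < rk [set: I])%N by rewrite rkT ltnS.
  case/rk_lt_out => j _ /span_separation[c c0 cj].
  have [||_ _ _ /(_ i)] := separating_functional pe vertexI uS vS uv (f := c).
  - by move=> s sS; apply: c0; rewrite inE sS orbT.
  - by exists j.
  by rewrite c0 ?setU11 // => /(_ erefl); rewrite (negPf iS).
split=> // s sS.
have : (rk S < rk [set: I])%N by rewrite rkT ltnS (leq_trans (rk_card _ _)).
case/rk_lt_out => j _ /span_separation[f fS fj].
have [||[x1 x1P] [y1 y1N] sep zS] := separating_functional pe vertexI uS vS uv (f := f).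
- by [].
- by exists j.
have cS1 : (#|S :\ s| < d)%N by rewrite (leq_trans _ cS) // (cardsD1 s S) sS.
have [lam [lamS lams]] : exists lam, (forall t, t \in S -> t != s -> dot (p t) lam = 0)
    /\ dot (p s) lam = 1.
  (* The set [u |: S :\ s] has at most [d] points, while [u |: S] has rank [d + 1]. *)
  have : ~~ (p s <= span_of (u |: S :\ s))%MS.
    apply/negP => ps; have := rkS u uS; apply/eqP; rewrite neq_ltn; apply/orP; left.
    apply: (@leq_trans (rk (u |: S :\ s)).+1).
      rewrite ltnS mxrankS // span_subP // => t.
      have [-> //|ts] := eqVneq t s.
      by move=> tS; apply: mem_span; move: tS; rewrite !inE ts.
    rewrite ltnS (leq_trans (rk_card _ _)) // cardsU1 (leq_trans _ cS1) //.
    by case: (_ \notin _).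
  case/span_separation => c c0 cs; exists ((dot (p s) c)^-1 *: c); split.
    move=> t tS ts; have tA : t \in u |: S :\ s by rewrite !inE ts tS orbT.
    by rewrite dotZr (c0 t) // mulr0.
  by rewrite dotZr mulVf.
have lamS0 t : t \in S -> 0 <= dot (p t) lam.
  by move=> tS; have [->|ts] := eqVneq t s; rewrite ?lams // lamS.
have x1Pos : x1 \in [set x | 0 < dot (p x) f] by rewrite inE.
have [x] := finite_argmax (fun x => - dot (p x) lam / dot (p x) f) x1Pos.
(* [kap] is the least slope making [lam + kap * f] nonnegative on the positive side; the value at
   [x] is then zero. *)
rewrite inE => fx xmax; set kap := - _ / _ in xmax.
pose a := lam + kap *: f.
have ax : dot (p x) a = 0.
  by rewrite !dotE /kap mulfVK ?gt_eqF // subrr.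
have aPos i : 0 < dot (p i) f -> 0 <= dot (p i) a.
  move=> fi; have := xmax i; rewrite inE fi => /(_ isT).
  by rewrite ler_pdivrMr // !dotE; lra.
have aS t : t \in S -> dot (p t) a = dot (p t) lam.
  by move=> tS; rewrite !dotE fS // mulr0 addr0.
have aNeg y : dot (p y) f < 0 -> 0 <= dot (p y) a.
  move=> fy; rewrite leNgt; apply/negP => ay.
  (* Among all segments from the positive to the negative side of the
     hyperplane, take one crossing it where lam is smallest. *)
  pose cr (z : I * I) := (dot (p z.2) lam * dot (p z.1) f - dot (p z.1) lam * dot (p z.2) f)
    / (dot (p z.1) f - dot (p z.2) f).
  have xyP : (x, y) \in [set z : I * I | (0 < dot (p z.1) f) && (dot (p z.2) f < 0)].
    by rewrite inE fx fy.
  have [[x0 y0]] := finite_argmax (fun z => - cr z) xyP.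
  rewrite inE /= => /andP[fx0 fy0] crmin.
  set w := cr (x0, y0) in crmin.
  have w_le x' y' : 0 < dot (p x') f -> dot (p y') f < 0 ->
      w * (dot (p x') f - dot (p y') f) <=
        dot (p y') lam * dot (p x') f - dot (p x') lam * dot (p y') f.
    move=> fx' fy'; have := crmin (x', y'); rewrite inE fx' fy' => /(_ isT).
    by rewrite lerN2 ler_pdivlMr // subr_gt0 (lt_trans fy').
  have w_eq : w * (dot (p x0) f - dot (p y0) f) =
        dot (p y0) lam * dot (p x0) f - dot (p x0) lam * dot (p y0) f.
    by rewrite /w /cr /= mulfVK // gt_eqF // subr_gt0 (lt_trans fy0).
  have w0 : w < 0.
    have := w_le x y fx fy; move: ax ay; rewrite !dotE => ax ay.
    have : 0 < dot (p x) f * - (dot (p y) lam + kap * dot (p y) f).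
      by rewrite mulr_gt0 // oppr_gt0.
    have -> : dot (p x) lam = - (kap * dot (p x) f) by lra.
    have : 0 < dot (p x) f - dot (p y) f by rewrite subr_gt0 (lt_trans fy).
    nra.
  (* With this slope [lam + kap0 * f] equals [w] at both [x0] and [y0]. Minimality of [w] makes [c]
     nonnegative, and on [S] it is [lam - w], which is positive. *)
  pose kap0 := (w - dot (p x0) lam) / dot (p x0) f.
  have Ex0 : kap0 * dot (p x0) f = w - dot (p x0) lam by rewrite mulfVK ?gt_eqF.
  have Ey0 : kap0 * dot (p y0) f = w - dot (p y0) lam.
    apply: (mulfI (lt0r_neq0 fx0)).
    rewrite mulrCA (mulrC (dot (p x0) f)) mulrCA Ex0; move: w_eq; clearbody w; lra.
  pose c := lam + kap0 *: f - w *: e.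
  have cE i : dot (p i) c = dot (p i) lam + kap0 * dot (p i) f - w.
    by rewrite !dotE pe mulr1.
  have cS_gt0 t : t \in S -> 0 < dot (p t) c.
    by move=> tS; rewrite cE fS // mulr0 addr0 subr_gt0 (lt_le_trans w0) ?lamS0.
  have c_ge0 i : 0 <= dot (p i) c.
    rewrite cE; have [fi|fi|fi] := ltgtP (dot (p i) f) 0.
    - have := w_le x0 i fx0 fi.
      have -> : dot (p x0) lam = w - kap0 * dot (p x0) f by lra.
      rewrite -subr_ge0 => H; rewrite -(pmulr_rge0 _ fx0); move: H; lra.
    - have := w_le i y0 fi fy0.
      have -> : dot (p y0) lam = w - kap0 * dot (p y0) f by lra.
      have fy0' : 0 < - dot (p y0) f by rewrite oppr_gt0.
      rewrite -subr_ge0 => H; rewrite -(pmulr_rge0 _ fy0'); move: H; lra.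
    - by rewrite -cE ltW // cS_gt0 // zS.
  (* The face [c = 0] contains [x0] and [y0] and misses [S]; being connected, it links the two
     sides. *)
  have eC : exposed [set i | dot (p i) c == 0] by exists c.
  have /negP := sep x0 y0 fx0 fy0; apply.
  apply: (@adj_within_subset _ _ _ p [set i | dot (p i) c == 0]).
    apply/subsetP => i; rewrite !inE => /eqP ci; apply/negP => /cS_gt0.
    by rewrite ci ltxx.
  by apply: (face_connected pe vertexI eC); rewrite inE cE ?Ex0 ?Ey0; apply/eqP; lra.
exists a; split.
- move=> i; have [/aNeg|/aPos|/zS iS] := ltgtP (dot (p i) f) 0 => //.
  by rewrite aS // lamS0.
- by move=> t tS ts; rewrite aS // lamS.
- by rewrite aS.
apply/eqP; rewrite eqn_leq; apply/andP; split.
  rewrite -ltnS -rkT; apply: (rk_proper (c := a)); rewrite ?subsetT //.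
    by move=> i; rewrite inE => /eqP.
  by exists s; rewrite // aS // lams oner_neq0.
(* Adding the single point [s] to the zero set of [a] gives a set containing [x |: S], of rank
   [d + 1]. *)
have xS : x \notin S by apply/negP => /fS fx0; rewrite fx0 ltxx in fx.
rewrite -ltnS -(rkS x xS).
apply: (@leq_trans (rk (s |: [set i | dot (p i) a == 0]))).
  apply/rk_subset/subsetP => i; rewrite !inE.
  have [->|/= i_s] := eqVneq i s; first by [].
  case/orP => [/eqP ->|iS]; first by rewrite ax eqxx.
  by rewrite aS // lamS ?eqxx.
rewrite /rk; apply: (@leq_trans (\rank (<<p s>> + span_of [set i | dot (p i) a == 0])%MS)).
  apply/mxrankS/span_subP => i; rewrite inE => /orP[].
    by rewrite inE => /eqP ->; apply: submx_trans (addsmxSl _ _); rewrite genmxE.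
  by move=> iA; apply: submx_trans (addsmxSr _ _); apply: mem_span.
apply: leq_trans (leq_of_leqif (mxrank_adds_leqif _ _)) _.
by rewrite -[X in (_ <= X)%N]add1n leq_add2r genmxE rank_leq_row.
Qed.

End Facets.

(** * Cubes *)

Section Cubes.
Variables (R : realFieldType) (m : nat) (I : finType).
Variables (p : I -> 'rV[R]_m) (e : 'cV[R]_m).
Hypothesis pe : forall i, dot (p i) e = 1.
Hypothesis vertexI : forall i, exposed p [set i].
Implicit Types (A B S T : {set I}) (l s t : I).

Local Notation exposed := (exposed p).
Local Notation rk := (rk p).
Local Notation span_of := (span_of p).
Local Notation adj_in := (adj_in p).
Local Notation linked S := (connect (adj_within p (~: S))).

(* The two properties of the faces of [0,1]^k that are needed, transported to
   the vertex set A: a nonempty face lies in the facet opposite to any vertex it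
   misses, for some direction, and every subcube is a face. *)
Definition cube_like A := exists k (phi : I -> {ffun 'I_k -> bool}),
  [/\ {in A &, injective phi}, forall x, exists2 i, i \in A & phi i = x,
      forall B t, exposed B -> B \subset A -> B != set0 -> t \in A -> t \notin B ->
        exists i, forall b, b \in B -> phi b i != phi t i
    & forall (w : {ffun 'I_k -> bool}) (J : {set 'I_k}),
        exposed [set l in A | [forall j in J, phi l j == w j]]].

(** The subcubes [B n], in which only the first [n] coordinates vary, form a strictly increasing
    chain of nonempty faces, so the rank grows at each step. *)
Lemma cube_dim_le A k (phi : I -> {ffun 'I_k -> bool}) :
  (forall x, exists2 i, i \in A & phi i = x) ->
  (forall (w : {ffun 'I_k -> bool}) (J : {set 'I_k}),
        exposed [set l in A | [forall j in J, phi l j == w j]]) ->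
  (k < rk A)%N.
Proof.
move=> surj sub.
pose B n := [set l in A | [forall j in [set j : 'I_k | (n <= j)%N], phi l j == [ffun=> false] j]].
have BP n l : reflect (l \in A /\ forall j : 'I_k, (n <= j)%N -> phi l j = false) (l \in B n).
  rewrite inE; apply: (iffP andP) => -[lA H]; split=> //.
    by move=> j nj; move/forall_inP: H => /(_ j); rewrite inE nj ffunE => /(_ isT)/eqP.
  by apply/forall_inP => j; rewrite inE => /H ->; rewrite ffunE.
suff rB n : (n <= k)%N -> (n < rk (B n))%N.
  by apply: leq_trans (rB k (leqnn k)) _; apply/rk_subset/subsetP => l /BP[].
elim: n => [_|n IH nk].
  have [i iA phii] := surj [ffun=> false].
  by apply: (rk_gt0 pe (i := i)); apply/BP; split=> // j _; rewrite phii ffunE.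
apply: leq_ltn_trans (IH (ltnW nk)) _; apply: exposed_rk_proper; first exact: sub.
apply/properP; split.
  by apply/subsetP => l /BP[lA H]; apply/BP; split=> // j /ltnW; apply: H.
have [i iA phii] := surj [ffun j : 'I_k => j == Ordinal nk].
exists i.
  apply/BP; split=> // j; rewrite phii ffunE => /gtn_eqF nj.
  by apply/eqP => jE; rewrite jE eqxx in nj.
by apply/negP => /BP[_ /(_ (Ordinal nk) (leqnn n))]; rewrite phii ffunE eqxx.
Qed.

(** Each [t] in [T] differs from the rest of [T] in a coordinate [dir t] of its own. There are at
    most as many coordinates as points in [T], so [dir] is a bijection, and [w] arises from any [t]
    by flipping the coordinate [dir t]. A face through [t] and [u] missing [w] would differ from [w]
    throughout in one coordinate, equal to both [dir t] and [dir u]. *)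
Lemma cube_nbhd A T : cube_like A -> exposed A -> T \subset A ->
  rk A = #|T|.+1 -> (2 < #|T|)%N ->
  (forall t, t \in T -> exists B, [/\ exposed B, T :\ t \subset B & t \notin B]) ->
  exists w, [/\ w \in A, forall t, t \in T -> adj_in w t &
    forall B t u, exposed B -> t \in T :&: B -> u \in T :&: B -> t != u -> w \in B].
Proof.
move=> [k [phi [inj surj split_off sub]]] eA TA rA cT sepT.
have TA' t : t \in T -> t \in A := subsetP TA t.
have dirT t : exists i : 'I_k, t \in T ->
    forall s, s \in T -> s != t -> phi s i != phi t i.
  have off t' : t' \in T -> exists i : 'I_k,
      forall s, s \in T -> s != t' -> phi s i != phi t' i.
    move=> tT; have [B [eB TB tB]] := sepT t' tT.
    have inB s : s \in T -> s != t' -> s \in B :&: A.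
      by move=> sT st; rewrite inE (TA' s sT) (subsetP TB) // !inE st sT.
    have [|||||i iP] := split_off (B :&: A) t'.
    - exact: exposedI.
    - exact: subsetIr.
    - apply/set0Pn; have /card_gt0P[s] : (0 < #|T :\ t'|)%N.
        by have := cT; rewrite (cardsD1 t' T) tT; lia.
      by rewrite !inE => /andP[st sT]; exists s; apply: inB.
    - exact: TA'.
    - by rewrite inE (negPf tB).
    by exists i => s sT st; apply: iP; apply: inB.
  have [/off[i iP]|tT] := boolP (t \in T); first by exists i.
  (* Off [T] the value is arbitrary, but ['I_k] has to be inhabited. *)
  have /card_gt0P[s /off[i _]] : (0 < #|T|)%N by rewrite (leq_trans _ cT).
  by exists i.
have {dirT}[dir dirP] := choice dirT.
have dir_inj : {in T &, injective dir}.
  move=> t u tT uT tu; apply/eqP; case: (eqVneq t u) => // ntu.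
  (* With a third point [s], a single boolean coordinate would take three distinct values. *)
  have /card_gt0P[s] : (0 < #|T :\ t :\ u|)%N.
    have := cT; rewrite (cardsD1 t T) tT (cardsD1 u (T :\ t)) !inE uT eq_sym ntu.
    by rewrite !add1n !ltnS.
  rewrite !inE => /and3P[su st sT].
  have := dirP t tT s sT st; have := dirP u uT s sT su.
  have := dirP u uT t tT ntu; rewrite tu.
  by case: (phi s _); case: (phi u _); case: (phi t _).
have cTk : (k <= #|dir @: T|)%N.
  by rewrite card_in_imset // -ltnS -rA (cube_dim_le surj sub).
have dir_surj i : exists t, t \in T /\ dir t = i.
  have /eqP/setP/(_ i) : dir @: T == setT by rewrite eqEcard subsetT cardsT card_ord.
  by rewrite inE => /imsetP[t tT ->]; exists t.
have [src srcP] := choice dir_surj.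
(* In each coordinate, [w] takes the value shared by all points of [T] except the one owning that
   coordinate. *)
have [w wA wE] := surj [ffun i => ~~ phi (src i) i].
have phiT t i : t \in T -> (phi t i != phi w i) = (i == dir t).
  move=> tT; have [sT si] := srcP i; rewrite wE ffunE.
  have [->|it] := eqVneq i (dir t).
    have -> : src (dir t) = t by apply: dir_inj => //; case: (srcP (dir t)).
    by case: (phi t _).
  have ts : t != src i by apply: contra_neq it => ->.
  by have := dirP _ sT t tT ts; rewrite si; case: (phi t i); case: (phi (src i) i).
exists w; split=> //.
  move=> t tT; apply/andP; split.
    by apply: contra_eq_neq (phiT t (dir t) tT) => ->; rewrite !eqxx.
  (* The edge is the subcube through [w] in which only the direction [dir t] is free. *)
  apply/asboolP; have := sub (phi w) (~: [set dir t]).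
  congr exposed; apply/setP => l; rewrite !inE; apply/andP/orP.
    move=> [lA /forall_inP lP].
    have [lw|lw] := eqVneq (phi l (dir t)) (phi w (dir t)).
      left; apply/eqP/inj => //; apply/ffunP => j.
      by have [->//|jt] := eqVneq j (dir t); apply/eqP/lP; rewrite !inE.
    right; apply/eqP/inj => //; first exact: TA'.
    apply/ffunP => j; have [->|jt] := eqVneq j (dir t).
      have := phiT t (dir t) tT; rewrite eqxx; move: lw.
      by case: (phi l _); case: (phi w _); case: (phi t _).
    transitivity (phi w j); first by apply/eqP/lP; rewrite !inE.
    by apply/eqP; have := phiT t j tT; rewrite (negPf jt) eq_sym => /negbFE.
  case=> /eqP ->.
    by split=> //; apply/forall_inP.
  split; first exact: TA'.
  by apply/forall_inP => j; rewrite !inE => jt; have := phiT t j tT; rewrite (negPf jt) => /negbFE.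
move=> B t u eB /setIP[tT tB] /setIP[uT uB] tu; apply: contraNT tu => wB.
have [|||||i iP] := split_off (B :&: A) w.
- exact: exposedI.
- exact: subsetIr.
- by apply/set0Pn; exists t; rewrite inE tB TA'.
- by [].
- by rewrite inE (negPf wB).
have := iP t; rewrite inE tB TA' // => /(_ isT); rewrite phiT // => /eqP it.
have := iP u; rewrite inE uB TA' // => /(_ isT); rewrite phiT // => /eqP iu.
by apply/eqP/dir_inj => //; rewrite -it.
Qed.

Variable d : nat.
Hypothesis rkT : rk [set: I] = d.+1.
Hypothesis facet_cube : forall A, exposed A -> rk A = d -> cube_like A.

Theorem separator_simple S u v : (3 < d)%N -> (#|S| <= d)%N ->
  u \notin S -> v \notin S -> ~~ linked S u v -> exists w, #|nbrs p w| = d.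
Proof.
move=> d4 cS uS vS uv.
have [rkS facetS] := separator_facets pe vertexI rkT cS uS vS uv.
have {}cS : #|S| = d.
  apply/eqP; rewrite eqn_leq cS /= -ltnS -(rkS u uS).
  by apply: leq_trans (rk_card _ _) _; rewrite cardsU1 uS.
have /choice[a aP] : forall s, exists a, s \in S -> [/\ forall i, 0 <= dot (p i) a,
    forall t, t \in S -> t != s -> dot (p t) a = 0, dot (p s) a = 1
    & rk [set i | dot (p i) a == 0] = d].
  move=> s; have [/facetS[a ?]|_] := boolP (s \in S); first by exists a.
  by exists 0.
pose F s := [set i | dot (p i) (a s) == 0].
have eF s : s \in S -> exposed (F s) by move=> /aP[a0 _ _ _]; exists (a s).
have tF s t : s \in S -> t \in S -> (t \in F s) = (t != s).
  move=> /aP[_ ast ass _] tS; rewrite inE; have [->|ts] := eqVneq t s.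
    by rewrite ass oner_eq0.
  by rewrite ast ?eqxx.
have cD s : s \in S -> #|S :\ s| = d.-1.
  by move=> sS; rewrite -cS (cardsD1 s S) sS.
have apex s : s \in S -> exists w, (forall t, t \in S -> w \in F t) /\
    forall t, t \in S -> t != s -> adj_in w t.
  move=> sS; have [_ _ _ rF] := aP s sS.
  have [|||t|w [wF wadj wB]] := @cube_nbhd (F s) (S :\ s) (facet_cube (eF s sS) rF) (eF s sS).
  - by apply/subsetP => t /setD1P[ts tS]; rewrite tF.
  - by rewrite cD // prednK // (leq_trans _ d4).
  - by rewrite cD //; lia.
  - case/setD1P => ts tS; exists (F t); split; first exact: eF.
      by apply/subsetP => x /setD1P[xt /setD1P[_ xS]]; rewrite tF.
    by rewrite tF // eqxx.
  exists w; split=> t tS; last by move=> ts; apply: wadj; rewrite !inE ts.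
  have [->//|ts] := eqVneq t s.
  (* As [d >= 4], the face [F t] contains two points of [S \ {s}], hence also [w]. *)
  have : (1 < #|S :\ s :\ t|)%N.
    by have := cD s sS; rewrite (cardsD1 t (S :\ s)) !inE ts tS; lia.
  case/card_gt1P => x [y [/setD1P[xt /setD1P[xs xS]] /setD1P[yt /setD1P[ys yS]] xy]].
  by apply: (wB (F t) x y) => //; [exact: eF | rewrite in_setI tF // !inE xs xS xt
    | rewrite in_setI tF // !inE ys yS yt].
have outS w : (forall t, t \in S -> w \in F t) -> w \notin S.
  by move=> wF; apply/negP => wS; have := wF w wS; rewrite tF // eqxx.
(* The functionals a t are the barycentric coordinates dual to S, with apex w. *)
have coord w i : (forall t, t \in S -> w \in F t) ->
    exists beta, p i = \sum_(t in S) dot (p i) (a t) *: p t + beta *: p w.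
  move=> wF; have wS := outS w wF.
  have : (p i <= span_of (w |: S))%MS.
    have : (span_of (w |: S) == span_of [set: I])%MS.
      by rewrite -(geq_leqif (mxrank_leqif_eq (span_subset _ (subsetT _)))) -!/(rk _) rkS ?rkT.
    by move/eqmxP => ->; rewrite mem_span.
  case/span_coef => mu; rewrite big_setU1 //= => Ei.
  exists (mu w); rewrite {1}Ei addrC; congr (_ + _); apply: eq_bigr => t tS.
  congr (_ *: _); have [_ ast ass _] := aP t tS.
  rewrite Ei dotDl dotZl; have := wF t tS; rewrite inE => /eqP ->.
  rewrite mulr0 add0r dot_suml (bigD1 t) //= dotZl ass mulr1 big1 ?addr0 // => s /andP[sS st].
  by rewrite dotZl ast ?mulr0.
(* All coordinates of [w'] along [S] vanish, so [p w'] is a multiple of [p w], and [e] shows the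
   factor to be 1. *)
have apex_uniq w w' : (forall t, t \in S -> w \in F t) ->
    (forall t, t \in S -> w' \in F t) -> w' = w.
  move=> wF w'F; have [beta E] := coord w w' wF.
  have {}E : p w' = beta *: p w.
    rewrite E big1 ?add0r // => t tS.
    by have := w'F t tS; rewrite inE => /eqP ->; rewrite scale0r.
  have := congr1 (fun x => dot x e) E; rewrite dotZl !pe mulr1 => b1.
  by apply: (point_inj vertexI); rewrite E -b1 scale1r.
(* The apex for [s] is known to be adjacent to all of [S] but [s]; the one for [s'] settles [s]. *)
have /card_gt1P[s [s' [sS s'S ss']]] : (1 < #|S|)%N by rewrite cS; lia.
have [w [wF wadj]] := apex s sS.
have [w' [w'F w'adj]] := apex s' s'S.
rewrite (apex_uniq w w' wF w'F) in w'adj.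
exists w; rewrite -cS; apply: eq_card => x; rewrite inE.
apply/idP/idP => [wx|xS]; last first.
  have [->|xs] := eqVneq x s; [exact: w'adj | exact: wadj].
(* The functional [b] of an edge from [w] to [x] outside [S] is positive on [S]. Its value at [x] is
   a sum of nonnegative terms and is zero, so every [a t] vanishes at [x], and [x] is the apex. *)
apply/negPn/negP => xS; case/andP: wx => wx /asboolP[b b0 bE].
have bP i : (i \in [set w; x]) = (dot (p i) b == 0) by rewrite bE inE.
have bw : dot (p w) b = 0 by apply/eqP; rewrite -bP !inE eqxx.
have bx : dot (p x) b = 0 by apply/eqP; rewrite -bP !inE eqxx orbT.
have [beta Ex] := coord w x wF; have := congr1 (fun y => dot y b) Ex.
rewrite bx dotDl dotZl bw mulr0 addr0 dot_suml => /esym/eqP.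
rewrite psumr_eq0 => [/allP H|t tS]; last first.
  by rewrite dotZl mulr_ge0 // ?b0 //; case: (aP t tS).
have ax t : t \in S -> x \in F t.
  move=> tS; have := H t (mem_index_enum t); rewrite tS dotZl mulf_eq0 inE.
  case/orP => //; rewrite -bP !inE => /orP[] /eqP tE.
    by have := outS w wF; rewrite -tE tS.
  by rewrite -tE tS in xS.
by rewrite (apex_uniq w x wF ax) eqxx in wx.
Qed.

End Cubes.

(** * Dimension at most three *)

Lemma mxrank_lt_functional (F : fieldType) m n1 n2 (M : 'M[F]_(n1, m))
    (N : 'M[F]_(n2, m)) (x : 'rV_m) (c : 'cV_m) :
  (M <= N)%MS -> (x <= N)%MS -> M *m c = 0 -> dot x c != 0 -> (\rank M < \rank N)%N.
Proof.
move=> MN xN Mc xc; rewrite ltn_neqAle mxrankS // andbT.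
apply: contra xc => /eqP rMN; have: (N <= M)%MS.
  by rewrite -(geq_leqif (mxrank_leqif_sup MN)) rMN.
by move/(submx_trans xN)/submxP => [D ->]; rewrite /dot -mulmxA Mc mulmx0 mxE.
Qed.

(** The functional is sought on the moment curve, with coefficients [t ^+ k]: each difference
    [p i - p j] gives a nonzero polynomial in [t], and [t] has to avoid the roots of their
    product. *)
Lemma generic_functional (R : realFieldType) m (I : finType) (p : I -> 'rV[R]_m) :
  injective p -> exists g, injective (fun i => dot (p i) g).
Proof.
move=> pinj; pose P i j : {poly R} := \sum_(k < m) (p i - p j) 0 k *: 'X^k.
have P0 i j : i != j -> P i j != 0.
  move=> ij; have : p i - p j != 0 by rewrite subr_eq0 (inj_eq pinj).
  case/matrix0Pn => z [k]; rewrite ord1 => ijk; apply: contraNneq ijk => Pij.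
  have := congr1 (fun q : {poly R} => q`_k) Pij; rewrite coef0 coef_sum (bigD1 k) //=.
  rewrite coefZ coefXn eqxx mulr1 big1 ?addr0 => [->//|l lk].
  by rewrite coefZ coefXn eq_sym (inj_eq val_inj) (negPf lk) mulr0.
pose Q := \prod_(z : I * I | z.1 != z.2) P z.1 z.2.
have Q0 : Q != 0 by apply/prodf_neq0 => -[i j] /P0.
pose rs : seq R := [seq n%:R | n <- iota 0 (size Q)].
have urs : uniq rs.
  by rewrite map_inj_uniq ?iota_uniq // => a b /eqP; rewrite eqr_nat => /eqP.
have : ~~ all (root Q) rs.
  apply/negP => /(max_poly_roots Q0) /(_ urs).
  by rewrite size_map size_iota ltnn.
case/allPn => t _ Qt; exists (\col_k t ^+ k) => i j /eqP; apply: contraTeq => ij.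
have : root (P i j) t -> root Q t.
  move=> Pt; rewrite /root /Q horner_prod; apply/prodf_eq0.
  by exists (i, j).
move/contra/(_ Qt); apply: contra; rewrite -subr_eq0 -dotBl => /eqP H.
apply/eqP; rewrite -[RHS]H /P horner_sum /dot mxE; apply: eq_bigr => k _.
by rewrite hornerZ hornerXn; congr (_ * _); rewrite mxE.
Qed.

(* The q i span distinct extreme rays of a pointed cone.  In a linear relation
   between at most three of them some sign occurs at most once, and the functional
   supporting the corresponding ray kills all the other coefficients. *)
Lemma extreme_rays_free (R : realFieldType) m k (q : 'I_k -> 'rV[R]_m)
    (a : 'I_k -> 'cV[R]_m) (b : 'cV[R]_m) :
  (k <= 3)%N -> (forall i, 0 < dot (q i) b) -> (forall i, dot (q i) (a i) = 0) ->
  (forall i j, i != j -> 0 < dot (q j) (a i)) -> row_free (\matrix_i q i).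
Proof.
move=> k3 qb qa qaj; rewrite -kermx_eq0; apply/eqP/row_matrixP => r; rewrite row0.
set c := row r _; have : \sum_i c 0 i *: q i = 0.
  have : c *m \matrix_i q i = 0 by apply/sub_kermxP; apply: row_sub.
  rewrite mulmx_sum_row => H; rewrite -[RHS]H.
  by apply: eq_bigr => i _; rewrite rowK.
move: c; clear r; suff main (c : 'rV[R]_k) : \sum_i c 0 i *: q i = 0 ->
    (#|[set i | (0 < c 0 i)%R]| <= 1)%N -> c = 0.
  move=> c sc; have [/(main c sc)//|pos] := leqP #|[set i | (0 < c 0 i)%R]| 1.
  apply: oppr_inj; rewrite oppr0; apply: main.
    transitivity (- \sum_i c 0 i *: q i); last by rewrite sc oppr0.
    by rewrite -sumrN; apply: eq_bigr => i _; rewrite mxE scaleNr.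
  have : [disjoint [set i | 0 < c 0 i] & [set i | 0 < (- c) 0 i]].
    rewrite disjoints_subset; apply/subsetP => i; rewrite !inE mxE oppr_gt0 => ci.
    by rewrite -leNgt ltW.
  rewrite -leq_card_setU => /eqP dis.
  have := max_card (mem ([set i | 0 < c 0 i] :|: [set i | 0 < (- c) 0 i])).
  rewrite dis card_ord => H; rewrite -(leq_add2l 2).
  exact: leq_trans (leq_add pos (leqnn _)) (leq_trans H k3).
move=> sc pos; have qsum f : \sum_i c 0 i * dot (q i) f = 0.
  have := congr1 (fun x => dot x f) sc; rewrite dot_suml dot0l => H; rewrite -[RHS]H.
  by apply: eq_bigr => i _; rewrite dotZl.
have nonpos : forall i, c 0 i <= 0.
  have [i ci|none] := pickP (fun i => 0 < c 0 i); last by move=> i; rewrite leNgt none.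
  have neg j : j != i -> c 0 j <= 0.
    move=> ji; rewrite leNgt; apply: contra ji => cj.
    by apply/eqP/(card_le1_eqP pos); rewrite inE; [exact: ci | exact: cj].
  exfalso; have := qsum (a i); rewrite (bigD1 i) //= qa mulr0 add0r => /eqP.
  rewrite -oppr_eq0 -sumrN psumr_eq0 => [/allP H|j /neg cj]; last first.
    by rewrite oppr_ge0 mulr_le0_ge0 //; have [->|] := eqVneq i j; rewrite ?qa // => /qaj/ltW.
  have c0 j : j != i -> c 0 j = 0.
    move=> ji; have := H j (mem_index_enum j); rewrite ji /= oppr_eq0 mulf_eq0.
    by rewrite eq_sym in ji; rewrite (gt_eqF (qaj _ _ ji)) orbF => /eqP.
  have := qsum b; rewrite (bigD1 i) //= big1 => [|j /c0 ->]; last by rewrite mul0r.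
  by rewrite addr0 => /eqP; rewrite gt_eqF // mulr_gt0.
have := qsum b => /eqP; rewrite -oppr_eq0 -sumrN psumr_eq0 => [/allP H|j _]; last first.
  by rewrite oppr_ge0 mulr_le0_ge0 // ltW.
apply/rowP => j; rewrite mxE; have := H j (mem_index_enum j).
by rewrite /= oppr_eq0 mulf_eq0 (gt_eqF (qb j)) orbF => /eqP.
Qed.

Section LowDimension.
Variables (R : realFieldType) (m : nat) (I : finType).
Variables (p : I -> 'rV[R]_m) (e : 'cV[R]_m).
Hypothesis pe : forall i, dot (p i) e = 1.
Hypothesis vertexI : forall i, exposed p [set i].
Implicit Types (A B C : {set I}) (i j l : I).

Local Notation exposed := (exposed p).
Local Notation rk := (rk p).
Local Notation span_of := (span_of p).
Local Notation adj_in := (adj_in p).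
Local Notation nbrs := (nbrs p).

(** The edge directions at [i] are extreme rays of a cone, so [rk A] of them would be independent.
    But they lie in the part of the span of [A] where [e] vanishes, whose dimension is one less. *)
Lemma face_nbrs_card A i : i \in A -> (rk A <= 3)%N -> (#|nbrs i :&: A| < rk A)%N.
Proof.
move=> iA rA; rewrite ltnNge; apply/negP => large.
pose x (n : 'I_(rk A)) := enum_val (widen_ord large n).
have xP n : x n \in nbrs i :&: A := enum_valP _.
have xinj : injective x by move=> n n' /enum_val_inj/(congr1 val) E; apply: val_inj.
have xA n : x n \in A by case/setIP: (xP n).
have [b [bi b0 bpos]] := vertex_functional vertexI i.
have xi n : x n != i by case/setIP: (xP n); rewrite inE eq_sym => /andP[].
have /choice[a aP] : forall n, exists a, [/\ dot (p i) a = 0, dot (p (x n)) a = 0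
    & forall n', n != n' -> 0 < dot (p (x n')) a].
  move=> n; case/setIP: (xP n); rewrite inE => /andP[_ /asboolP[a a0 aE]] _.
  have aP j : (j \in [set i; x n]) = (dot (p j) a == 0) by rewrite aE inE.
  exists a; split=> [||n' nn']; try by apply/eqP; rewrite -aP !inE eqxx ?orbT.
  by rewrite lt_def a0 andbT -aP !inE negb_or xi (inj_eq xinj) eq_sym.
have := @extreme_rays_free _ _ _ (fun n => p (x n) - p i) a b rA.
rewrite /row_free; set Q := (\matrix_i _) => H.
have {H} rQ : \rank Q = rk A.
  apply/eqP/H => [n|n|n n' nn']; case: (aP n) => ai ax axpos.
  - by rewrite dotBl bi subr0 bpos.
  - by rewrite dotBl ai ax subrr.
  - by rewrite dotBl ai subr0 axpos.
have : (\rank Q < rk A)%N.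
  apply: (mxrank_lt_functional (c := e) (x := p i)); rewrite ?mem_span // ?pe ?oner_neq0 //.
    by apply/row_subP => n; rewrite rowK addmx_sub ?eqmx_opp ?mem_span.
  apply/row_matrixP => n; rewrite row_mul rowK row0.
  apply/matrixP => z z'; rewrite !ord1 [RHS]mxE.
  by rewrite -/(dot _ _) dotBl !pe subrr.
by rewrite rQ ltnn.
Qed.

Lemma low_dimension_nbrs d i : rk [set: I] = d.+1 -> (d <= 2)%N -> #|nbrs i| = d.
Proof.
move=> rT d2; apply/eqP; rewrite eqn_leq (nbrs_card_ge pe vertexI rT) andbT.
by have := face_nbrs_card (in_setT i); rewrite setIT rT !ltnS => ->.
Qed.

Hypothesis rT : rk [set: I] = 4%N.
Definition facets := [set A | `[< exposed A >] && (rk A == 3%N)].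

Lemma facetsP A : reflect (exposed A /\ rk A = 3%N) (A \in facets).
Proof. by rewrite inE; apply: (iffP andP) => -[/asboolP ? /eqP ?]. Qed.

Lemma facets_subset A B : A \in facets -> B \in facets -> A \subset B -> A = B.
Proof.
move=> /facetsP[eA rA] /facetsP[_ rB] AB; apply/eqP; rewrite eqEproper AB /=.
by apply/negP => /(exposed_rk_proper eA); rewrite rA rB.
Qed.

(** The supporting hyperplane of the edge is tilted about it in the two opposite directions [h] and
    [- h], until it meets a facet on either side. *)
Lemma edge_facets i j : adj_in i j -> (1 < #|[set A in facets | (i \in A) && (j \in A)]|)%N.
Proof.
move=> /andP[ij /asboolP eij]; have [b b0 bE] := eij.
have bP l : (l \in [set i; j]) = (dot (p l) b == 0) by rewrite bE inE.
have rij : (1 < rk [set i; j])%N.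
  apply: (@leq_trans (rk [set i]).+1); first by rewrite ltnS (rk_gt0 pe (set11 i)).
  apply: exposed_rk_proper => //; apply/properP; split; first exact: subsetUl.
  by exists j; rewrite !inE ?eqxx ?orbT // eq_sym.
have [l _ lij] : exists2 l, l \in [set: I] & ~~ (p l <= span_of [set i; j])%MS.
  by apply: rk_lt_out; rewrite rT (leq_ltn_trans (rk_card _ _)) // cards2; case: (_ != _).
have : (rk (l |: [set i; j]) < rk [set: I])%N.
  rewrite rT (leq_ltn_trans (rk_card _ _)) // cardsU1 cards2.
  by case: (_ \notin _); case: (_ != _).
case/rk_lt_out => x _ /span_separation[h h0 hx].
have hl : dot (p l) h = 0 by apply: h0; rewrite !inE eqxx.
have hij y : dot (p y) b = 0 -> dot (p y) h = 0.
  by move/eqP; rewrite -bP => yij; apply: h0; rewrite inE yij orbT.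
have bl : 0 < dot (p l) b.
  by rewrite lt_def b0 andbT -bP; apply: contra lij => /mem_span; apply.
have bx : 0 < dot (p x) b.
  by rewrite lt_def b0 andbT; apply: contra hx => /eqP/hij ->.
have turn h' : dot (p l) h' = 0 -> dot (p x) h' != 0 ->
    (forall y, dot (p y) b = 0 -> dot (p y) h' = 0) ->
    exists rho, [/\ [set y | rho * dot (p y) b == dot (p y) h'] \in facets,
      exists2 y, dot (p y) b != 0 & rho * dot (p y) b = dot (p y) h' &
      forall y, dot (p y) h' <= rho * dot (p y) b].
  move=> h'l h'x h'ij; have [|||rho] := @tilt _ _ _ p _ b h' (exposed_setT p).
  - by move=> y _.
  - by move=> y _ /h'ij ->.
  - by exists l; rewrite // gt_eqF.
  rewrite (_ : [set y in _ | _] = [set y | rho * dot (p y) b == dot (p y) h']); last first.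
    by apply/setP => y; rewrite !inE.
  move=> [eB [y _ [by0 yE]] rhole]; exists rho; split; [|by exists y|by move=> z; apply: rhole].
  set B := [set y | _] in eB *; apply/facetsP; split=> //; apply/eqP.
  rewrite eqn_leq -ltnS -rT; apply/andP; split.
    apply: exposed_rk_proper eB _; apply/properP; split; first exact: subsetT.
    have [xB|xB] := boolP (x \in B); last by exists x.
    exists l => //; rewrite inE h'l mulf_eq0 (gt_eqF bl) orbF.
    by apply: contra h'x => /eqP rho0; move: xB; rewrite inE rho0 mul0r eq_sym.
  apply: leq_ltn_trans rij _; apply: exposed_rk_proper eij _; apply/properP; split.
    apply/subsetP => z; rewrite bP => /eqP bz; rewrite inE bz mulr0.
    by rewrite h'ij // eqxx.
  by exists y; [rewrite inE yE | rewrite bP].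
have [rho1 [F1 [y1 by1 y1E] le1]] := turn h hl hx hij.
have [|||rho2 [F2 _ le2]] := turn (- h).
- by rewrite dotNr hl oppr0.
- by rewrite dotNr oppr_eq0.
- by move=> y /hij; rewrite dotNr => ->; rewrite oppr0.
set B1 := [set y | _] in F1; set B2 := [set y | _] in F2.
have inB y : y \in [set i; j] -> (y \in B1) && (y \in B2).
  by rewrite bP !inE => /eqP yb; rewrite yb dotNr hij // !mulr0 oppr0 !eqxx.
apply/card_gt1P; exists B1, B2; split.
- by rewrite inE F1; have /andP[-> _] := inB i (set21 _ _); have /andP[-> _] := inB j (set22 _ _).
- by rewrite inE F2; have /andP[_ ->] := inB i (set21 _ _); have /andP[_ ->] := inB j (set22 _ _).
(* If the facets agreed, their slopes would be opposite. Both are nonnegative because of [l], hence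
   zero, and then [h] would vanish at [x]. *)
apply/eqP => B12; have : y1 \in B2 by rewrite -B12 inE y1E.
rewrite inE dotNr -y1E -mulNr => /eqP/(mulIf by1) rho12.
have := le1 l; rewrite hl pmulr_lge0 // => rho1_ge0.
have := le2 l; rewrite dotNr hl oppr0 pmulr_lge0 // => rho2_ge0.
have rho10 : rho1 = 0 by lra.
have rho20 : rho2 = 0 by lra.
have := le1 x; have := le2 x; rewrite rho10 rho20 !mul0r dotNr oppr_le0 => h1 h2.
by move: hx; rewrite eq_le h1 h2.
Qed.

(** Double counting of the pairs of a neighbour [j] and a facet through [i] and [j]: each neighbour
    is in at least two pairs, each facet in at most two. *)
Lemma facets_at i : (#|nbrs i| <= #|[set A in facets | i \in A]|)%N.
Proof.
rewrite -(leq_pmul2r (isT : (0 < 2)%N)) -!sum_nat_const.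
apply: (@leq_trans (\sum_(j in nbrs i) #|[set A in facets | (i \in A) && (j \in A)]|)).
  by apply: leq_sum => j; rewrite inE => /edge_facets.
under eq_bigr do rewrite -sum1_card.
rewrite (exchange_big_dep (mem [set A in facets | i \in A])) /= => [|j A _]; last first.
  by move=> /setIdP[Af /andP[iA _]]; rewrite inE Af.
apply: leq_sum => A /setIdP[/facetsP[_ rA] iA].
rewrite sum1_card -ltnS -rA; apply: leq_ltn_trans (face_nbrs_card iA _); rewrite ?rA //.
by apply/subset_leq_card/subsetP => j /andP[ij /setIdP[_ /andP[_ jA]]]; rewrite in_setI ij.
Qed.

Variable g : 'cV[R]_m.
Hypothesis ginj : injective (fun i => dot (p i) g).
Local Notation ht i := (dot (p i) g).

Definition middle A i := (i \in A) &&
  [exists j in A, exists l in A, (ht j < ht i) && (ht i < ht l)].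

(** Each such facet cuts the level plane of [g] through [p i] in an extreme ray of a cone. Three of
    these rays would be independent, but rank four leaves only dimension two for the common kernel
    of [e] and [g]. *)
Lemma middle_facets i : (#|[set A in facets | middle A i]| <= 2)%N.
Proof.
rewrite leqNgt; apply/negP => large.
pose F (n : 'I_3) := enum_val (widen_ord large n).
have FP n : F n \in [set A in facets | middle A i] := enum_valP _.
have Finj : injective F by move=> n n' /enum_val_inj/(congr1 val) E; apply: val_inj.
have [b [bi b0 bpos]] := vertex_functional vertexI i.
have Ff n : F n \in facets by case/setIdP: (FP n).
have iF n : i \in F n by case/setIdP: (FP n) => _ /andP[].
have /choice[lo loP] : forall n, exists j, j \in F n /\ ht j < ht i.
  move=> n; case/setIdP: (FP n) => _ /andP[_ /exists_inP[j jF /exists_inP[l lF /andP[ji _]]]].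
  by exists j.
have /choice[hi hiP] : forall n, exists j, j \in F n /\ ht i < ht j.
  move=> n; case/setIdP: (FP n) => _ /andP[_ /exists_inP[j jF /exists_inP[l lF /andP[_ ji]]]].
  by exists l.
have /choice[a aP] : forall n, exists a, (forall j, 0 <= dot (p j) a) /\
    forall j, (j \in F n) = (dot (p j) a == 0).
  move=> n; case/facetsP: (Ff n) => -[a a0 aE] _; exists a; split=> // j.
  by rewrite {1}aE inE.
have a_eq0 n j : j \in F n -> dot (p j) (a n) = 0.
  by move=> jF; apply/eqP; rewrite -(aP n).2.
pose al n := ht (hi n) - ht i; pose be n := ht i - ht (lo n).
have al0 n : 0 < al n by rewrite subr_gt0; case: (hiP n).
have be0 n : 0 < be n by rewrite subr_gt0; case: (loP n).
(* q n is the direction in which the facet F n meets the level of p i. *)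
pose q n := al n *: (p (lo n) - p i) + be n *: (p (hi n) - p i).
have qE n c : dot (q n) c = al n * (dot (p (lo n)) c - dot (p i) c)
    + be n * (dot (p (hi n)) c - dot (p i) c) by rewrite !dotE.
have ne_i j : ht j != ht i -> j != i by apply: contra_neq => ->.
have := @extreme_rays_free _ _ _ q a b (leqnn 3); rewrite /row_free.
set Q := (\matrix_i _) => H.
have {H} rQ : \rank Q = 3%N.
  apply/eqP/H => [n|n|n n' nn'].
  - have [_ lon] := loP n; have [_ hin] := hiP n.
    rewrite qE bi !subr0 addr_gt0 // mulr_gt0 // bpos // ne_i //.
      by rewrite lt_eqF.
    by rewrite gt_eqF.
  - have [loF _] := loP n; have [hiF _] := hiP n.
    by rewrite qE !a_eq0 // subrr !mulr0 addr0.
  have [a0 aF] := aP n; have [loF lo_lt] := loP n'; have [hiF hi_gt] := hiP n'.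
  have ge0 : 0 <= dot (q n') (a n).
    by rewrite qE (a_eq0 n i) // !subr0 addr_ge0 // mulr_ge0 // ltW.
  rewrite lt_def ge0 andbT; apply/negP.
  rewrite qE (a_eq0 n i) // !subr0 paddr_eq0 ?mulr_ge0 //; try exact/ltW.
  rewrite !mulf_eq0 !(gt_eqF (al0 _), gt_eqF (be0 _)) /= -!aF => /andP[loF' hiF'].
  (* If [q n'] lay on [F n], so would [lo n'] and [hi n']. The common face [C] of the two facets has
     rank at most 2, yet [i] would have a neighbour above and one below in it. *)
  pose C := F n :&: F n'.
  have [eF rF] := facetsP _ (Ff n); have [eF' _] := facetsP _ (Ff n').
  have eC : exposed C by apply: exposedI.
  have rC : (rk C < 3)%N.
    rewrite -rF; apply: exposed_rk_proper => //; rewrite properEneq subsetIl andbT.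
    apply: contra nn' => /eqP CF; apply/eqP/Finj/facets_subset => //.
    by rewrite -CF subsetIr.
  have iC : i \in C by rewrite inE !iF.
  have [|y [yC iy hy]] := nbr_above pe vertexI eC iC (j := hi n') (g := g) _ hi_gt.
    by rewrite inE hiF' hiF.
  have [||z [zC iz]] := nbr_above pe vertexI eC iC (j := lo n') (g := - g).
  - by rewrite inE loF' loF.
  - by rewrite !dotNr ltrN2.
  rewrite !dotNr ltrN2 => hz.
  have : (1 < #|nbrs i :&: C|)%N.
    apply/card_gt1P; exists y, z; split; try by apply/setIP; split; rewrite // inE.
    by apply: contraTneq hy => ->; rewrite -leNgt ltW.
  by move=> /leq_ltn_trans /(_ (face_nbrs_card iC (ltnW rC))); rewrite ltnNge -ltnS rC.
have [lo0F lo0] := loP ord0.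
(* The direction to [lo ord0] leaves the kernel of [g], and then [p i] leaves that of [e], so the
   total rank would be at least five. *)
have r4 : (\rank Q < \rank (Q + <<p (lo ord0) - p i>>)%MS)%N.
  apply: (mxrank_lt_functional (c := g) (x := p (lo ord0) - p i)).
  - exact: addsmxSl.
  - by apply: submx_trans (addsmxSr _ _); rewrite genmxE.
  - apply/row_matrixP => n; rewrite row_mul rowK row0.
    apply/matrixP => z z'; rewrite !ord1 [RHS]mxE -/(dot _ _) qE /al /be; ring.
  - by rewrite dotBl subr_eq0 lt_eqF.
have : (\rank (Q + <<p (lo ord0) - p i>>)%MS < rk [set: I])%N.
  apply: (mxrank_lt_functional (c := e) (x := p i)).
  - rewrite addsmx_sub; apply/andP; split.
      apply/row_subP => n; rewrite rowK.
      by rewrite addmx_sub // scalemx_sub // addmx_sub ?eqmx_opp ?mem_span ?inE.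
    by rewrite genmxE addmx_sub ?eqmx_opp ?mem_span ?inE.
  - by rewrite mem_span ?inE.
  - apply/sub_kermxP; rewrite addsmx_sub; apply/andP; split.
      apply/row_subP => n; rewrite rowK; apply/sub_kermxP/matrixP => z z'.
      by rewrite !ord1 [RHS]mxE -/(dot _ _) qE !pe subrr !mulr0 addr0.
    rewrite genmxE; apply/sub_kermxP/matrixP => z z'.
    by rewrite !ord1 [RHS]mxE -/(dot _ _) dotBl !pe subrr.
  - by rewrite pe oner_neq0.
by rewrite rT; rewrite rQ in r4; move/(leq_ltn_trans r4); rewrite ltnn.
Qed.

Lemma facet_middles A : (#|A| - 2 <= #|[set i | middle A i]|)%N.
Proof.
have [->|/set0Pn[x0 x0A]] := eqVneq A set0; first by rewrite cards0.
have [x xA xmax] := finite_argmax (fun i => ht i) x0A.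
have [y yA ymin] := finite_argmax (fun i => - ht i) x0A.
apply: (@leq_trans #|A :\ x :\ y|).
  have := cardsD1 x A; have := cardsD1 y (A :\ x).
  by case: (_ \in _); case: (_ \in _); lia.
apply/subset_leq_card/subsetP => i /setD1P[iy /setD1P[ix iA]].
rewrite inE /middle iA /=; apply/exists_inP; exists y => //.
apply/exists_inP; exists x => //; rewrite !lt_neqAle xmax // -lerN2 ymin // !andbT.
by rewrite !(inj_eq ginj) eq_sym iy ix.
Qed.

Lemma dimension3_nbrs : (forall A, A \in facets -> #|A| = 4%N) -> exists i, #|nbrs i| = 3%N.
Proof.
move=> card4; apply: contrapT => /forallNP no3.
have deg4 i : (4 <= #|nbrs i|)%N.
  by rewrite ltn_neqAle (nbrs_card_ge pe vertexI rT) andbT eq_sym; apply/eqP.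
(* Every vertex lies on at least four facets, and every facet has four vertices. *)
have incid : (#|I| * 4 <= #|facets| * 4)%N.
  rewrite -!sum_nat_const.
  apply: (@leq_trans (\sum_(i : I) #|[set A in facets | i \in A]|)).
    by apply: leq_sum => i _; apply: leq_trans (deg4 i) (facets_at i).
  under eq_bigr do rewrite -sum1_card.
  rewrite (exchange_big_dep (mem facets)) /= => [|i A _]; last by case/setIdP.
  apply: leq_sum => A Af; rewrite -(card4 A Af) -sum1_card.
  by apply/eq_leq/eq_bigl => i; rewrite inE Af.
have [x0 _] : exists i, i \in [set: I].
  by apply/set0Pn/eqP => T0; have := rk_card p [set: I]; rewrite rT T0 cards0.
have [x _ xmax] := finite_argmax (fun i => ht i) (in_setT x0).
(* The highest vertex [x] is in the middle of no facet. *)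
have : (#|facets| * 2 <= #|[set~ x]| * 2)%N.
  rewrite -!sum_nat_const.
  apply: (@leq_trans (\sum_(A in facets) #|[set i | middle A i]|)).
    by apply: leq_sum => A /card4 A4; have := facet_middles A; rewrite A4.
  under eq_bigr do rewrite -sum1_card.
  rewrite (exchange_big_dep (mem [set~ x])) /= => [|A i _]; last first.
    rewrite !inE => /andP[_ /exists_inP[j _ /exists_inP[l _ /andP[_ il]]]].
    by apply: contraTneq il => ->; rewrite -leNgt xmax.
  apply: leq_sum => i _; apply: leq_trans (middle_facets i).
  rewrite sum1_card; apply/eq_leq/eq_card => A.
  transitivity ((A \in facets) && (i \in [set i | middle A i])); first by [].
  by rewrite [RHS]inE inE.
have := cardsC1 x; have : (0 < #|I|)%N by apply/card_gt0P; exists x.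
lia.
Qed.

End LowDimension.

(** * Convex hulls *)

Lemma small_multiple (R : realFieldType) (I : finType) (A : {set I}) (u v : I -> R) :
  (forall i, i \in A -> 0 < v i) ->
  exists2 eps, 0 < eps & forall i, i \in A -> eps * u i < v i.
Proof.
move=> v0; pose M := 1 + \sum_(i in A) `|u i| / v i.
have M0 : 0 < M.
  by rewrite ltr_wpDr // sumr_ge0 // => i /v0 vi; rewrite divr_ge0 // ltW.
exists M^-1; first by rewrite invr_gt0.
move=> i iA; rewrite mulrC ltr_pdivrMr // mulrC -ltr_pdivrMr ?v0 //.
apply: (@le_lt_trans _ _ (`|u i| / v i)).
  by rewrite ler_pM2r ?invr_gt0 ?v0 // ler_norm.
rewrite /M (bigD1 i) //= addrCA ltrDl ltr_wpDr // sumr_ge0 // => j /andP[/v0 vj _].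
by rewrite divr_ge0 // ltW.
Qed.

(* Gordan's theorem, by induction on the number of vectors: a functional positive
   on all the others but not on x j is corrected after projecting along x j. *)
Lemma gordan (R : realFieldType) m (I : finType) (A : {set I}) (x : I -> 'rV[R]_m) :
  (exists c, forall i, i \in A -> 0 < dot (x i) c) \/
  (exists mu : I -> R, [/\ forall i, 0 <= mu i, exists2 i, i \in A & 0 < mu i
     & \sum_(i in A) mu i *: x i = 0]).
Proof.
have [n] := ubnP #|A|; elim: n => // n IH in A x * => /ltnSE cA.
have [->|/set0Pn[j jA]] := eqVneq A set0.
  by left; exists 0 => i; rewrite inE.
have cA' : (#|A :\ j| < n)%N by rewrite (leq_trans _ cA) // (cardsD1 j A) jA.
have sumA (f : I -> 'rV[R]_m) : \sum_(i in A) f i = f j + \sum_(i in A :\ j) f i.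
  by rewrite (big_setD1 j).
have combine k (mu : I -> R) : 0 <= k -> (forall i, 0 <= mu i) ->
    (exists2 i, i \in A :\ j & 0 < mu i) ->
    k *: x j + \sum_(i in A :\ j) mu i *: x i = 0 ->
    exists mu : I -> R, [/\ forall i, 0 <= mu i, exists2 i, i \in A & 0 < mu i
      & \sum_(i in A) mu i *: x i = 0].
  move=> k0 mu0 [i /setD1P[ij iA] mui] s0.
  exists (fun l => if l == j then k else mu l); split=> [l||].
  - by case: ifP.
  - by exists i; rewrite // (negPf ij).
  - rewrite sumA eqxx -[RHS]s0; congr (_ + _); apply: eq_bigr => l.
    by case/setD1P => /negPf ->.
have [[c cA0]|[mu [mu0 mui s0]]] := IH (A :\ j) x cA'; last first.
  by right; apply: (combine 0 mu); rewrite // scale0r add0r.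
have inA i : i \in A -> (i == j) || (i \in A :\ j) by rewrite !inE; case: (_ == _).
have [cj|cj|cj] := ltgtP (dot (x j) c) 0; last first.
(* If [x j] is zero, it is a relation by itself; otherwise a small perturbation of [c] becomes
   positive on it. *)
- have [xj|] := eqVneq (x j) 0.
    right; exists (fun i => (i == j)%:R); split=> [i||].
    + by case: (_ == _).
    + by exists j; rewrite // eqxx ltr01.
    + rewrite sumA xj scaler0 add0r big1 // => i.
      by case/setD1P => /negPf -> _; rewrite scale0r.
  case/matrix0Pn => z [k]; rewrite ord1 => xjk.
  have [eps eps0 small] := small_multiple (fun i => - dot (x i) (x j 0 k *: delta_mx k 0)) cA0.
  left; exists (c + eps *: (x j 0 k *: delta_mx k 0)) => i /inA/orP[/eqP ->|iA].
    rewrite !dotE cj add0r dot_delta mulr_gt0 // lt_def sqr_ge0 andbT.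
    by rewrite mulf_neq0.
  by have := small i iA; rewrite dotDr (dotZr eps); lra.
- by left; exists c => i /inA/orP[/eqP -> //|/cA0].
(* Now [c] is negative on [x j], and [x i - r i *: x j] is the projection along [x j] to the kernel
   of [c]. As [r i <= 0], a relation between the projections lifts with a nonnegative coefficient at
   [x j]. *)
pose r i := dot (x i) c / dot (x j) c.
have r_le0 i : i \in A :\ j -> r i <= 0.
  by move=> /cA0/ltW ci; rewrite mulr_ge0_le0 // invr_le0 ltW.
have [[c' c'A]|[mu [mu0 mui s0]]] := IH (A :\ j) (fun i => x i - r i *: x j) cA'.
  (* [c''] agrees with [c'] on the projections and vanishes on [x j]; subtracting a small multiple
     of [c] makes it positive there too. *)
  left; pose c'' := c' - (dot (x j) c' / dot (x j) c) *: c.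
  have c''E i : dot (x i - r i *: x j) c' = dot (x i) c''.
    by rewrite !dotE /r; field; rewrite lt_eqF.
  have c''j : dot (x j) c'' = 0 by rewrite !dotE divfK ?subrr // lt_eqF.
  have [i iA|eps eps0 small] := @small_multiple _ _ (A :\ j)
    (fun i => dot (x i) c) (fun i => dot (x i) c'').
    by rewrite -c''E c'A.
  exists (c'' - eps *: c) => i /inA/orP[/eqP ->|/small lt].
    by rewrite (dotBr _ c'') c''j sub0r dotZr oppr_gt0 pmulr_rlt0.
  by rewrite (dotBr _ c'') (dotZr eps) subr_gt0.
right; apply: (combine (\sum_(i in A :\ j) mu i * - r i) mu) => //.
  by apply: sumr_ge0 => i iA; rewrite mulr_ge0 // oppr_ge0 r_le0.
rewrite scaler_suml -big_split /= -[RHS]s0; apply: eq_bigr => i _.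
by rewrite mulrN scaleNr scalerBr scalerA addrC.
Qed.

From mathcomp Require Import classical_sets functions cardinality reals.
From mathcomp Require Import interval_inference convex.
Local Open Scope classical_set_scope.
Local Open Scope card_scope.

Section Hull.
Variables (R : realType) (n : nat).
Local Notation V := 'rV[R]_n.

Definition hull (I : finType) (p : I -> V) (A : {set I}) : set V :=
  [set x | exists mu : I -> R, [/\ forall i, 0 <= mu i,
     forall i, i \notin A -> mu i = 0, \sum_i mu i = 1 & x = \sum_i mu i *: p i]].

Lemma hull_convex (I : finType) (p : I -> V) A :
  @convex_set R V (hull p A).
Proof.
move=> x y l; rewrite !inE => -[mu [mu0 muA mu1 ->]] [nu [nu0 nuA nu1 ->]].
exists (fun i => l%:num * mu i + (1 - l%:num) * nu i); split=> [i|i iA||].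
- by rewrite addr_ge0 // mulr_ge0 // subr_ge0.
- by rewrite muA // nuA // !mulr0 addr0.
- by rewrite big_split /= -!mulr_sumr mu1 nu1 !mulr1 addrC subrK.
- rewrite /conv /= !scaler_sumr -big_split /=; apply: eq_bigr => i _.
  by rewrite [RHS]scalerDl -!scalerA.
Qed.

Lemma mem_hull (I : finType) (p : I -> V) (A : {set I}) i : i \in A -> hull p A (p i).
Proof.
move=> iA; exists (fun j => (j == i)%:R); split=> [j|j||].
- by case: (_ == _).
- by apply: contraNeq; rewrite pnatr_eq0 eqb0 negbK => /eqP ->.
- by rewrite (bigD1 i) //= eqxx big1 ?addr0 // => j /negPf ->.
- by rewrite (bigD1 i) //= eqxx scale1r big1 ?addr0 // => j /negPf ->; rewrite scale0r.
Qed.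

(** Induction on the list of points for normalised partial sums, which exist only once the weight is
    positive. *)
Lemma convex_combination (I : finType) (p : I -> V) (M : set V) (mu : I -> R) :
  @convex_set R V M -> (forall i, M (p i)) -> (forall i, 0 <= mu i) ->
  \sum_i mu i = 1 -> M (\sum_i mu i *: p i).
Proof.
move=> cM Mp mu0 mu1.
suff main (s : seq I) : 0 < \sum_(i <- s) mu i ->
    M ((\sum_(i <- s) mu i)^-1 *: \sum_(i <- s) mu i *: p i).
  by have := main (index_enum I); rewrite mu1 invr1 scale1r; apply.
elim: s => [|i s IH]; first by rewrite big_nil ltxx.
rewrite !big_cons; set t := \sum_(j <- s) mu j; set y := \sum_(j <- s) _.
have : 0 <= t by apply: sumr_ge0.
rewrite le_eqVlt => /predU1P[t0|t0].
  have -> : y = 0.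
    rewrite /y big_seq big1 // => j js; have : \sum_(j <- s) mu j == 0 by rewrite -/t -t0.
    by rewrite psumr_eq0 // => /allP /(_ j js) /eqP ->; rewrite scale0r.
  by rewrite -t0 !addr0 => mi; rewrite scalerA mulVf ?scale1r // gt_eqF.
move=> s0; have l0 : 0 <= mu i / (mu i + t) by rewrite divr_ge0 // ltW.
have l1 : mu i / (mu i + t) <= 1 by rewrite ler_pdivrMr // mul1r lerDl ltW.
have := cM (p i) (t^-1 *: y) (Itv01 l0 l1); rewrite !inE => /(_ (Mp i) (IH t0)).
congr M; rewrite /conv /= scalerDr !scalerA; congr (_ *: _ + _ *: _); first exact: mulrC.
by rewrite [X in X * _](_ : _ = 1 - mu i / (mu i + t)) //; field; rewrite !gt_eqF.
Qed.

Lemma smallest_convex_hull (A : set V) : finite_set A ->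
  exists N (p : 'I_N -> V), smallest (@convex_set R V) A = hull p [set: 'I_N]%SET.
Proof.
move=> /finite_seqP[s ->]; exists (size s), (tnth (in_tuple s)).
apply/seteqP; split.
  apply: smallest_sub; first exact: hull_convex.
  move=> x /= xs; have [i ->] := seq_tnthP (xs : x \in in_tuple s).
  by apply: mem_hull; rewrite inE.
move=> x [mu [mu0 _ mu1 ->]] M [cM sM].
by apply: convex_combination => // i; apply: sM; rewrite /= mem_tnth.
Qed.

(** The number of generators is taken minimal. If no functional is strictly minimal at [p j],
    Gordan's theorem gives a nonnegative relation between the [p i - p j], which makes [p j] a
    convex combination of the others. *)
Lemma polytope_vertices (P : set V) : polytope P ->
  exists N (p : 'I_N -> V), P = hull p [set: 'I_N]%SET /\
    forall j, exists c, forall i, i != j -> dot (p j) c < dot (p i) c.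
Proof.
move=> [A [/smallest_convex_hull[N0 [p0 p0E]] PE]].
have exN : exists N, `[< exists p : 'I_N -> V, P = hull p [set: 'I_N]%SET >].
  by exists N0; apply/asboolP; exists p0; rewrite PE.
case: (ex_minnP exN) => N /asboolP[p pE] Nmin; exists N, p; split=> // j.
case: N => [|N] in p pE Nmin j *; first by case: j.
have [[c cP]|[mu [mu0 [k _ muk] mus]]] :=
    gordan [set: 'I_N]%SET (fun i => p (lift j i) - p j).
  exists c => i; case: (unliftP j i) => [k ->|->]; last by rewrite eqxx.
  by have := cP k; rewrite inE dotBl subr_gt0 => /(_ isT).
exfalso; suff : (N < N)%N by rewrite ltnn.
apply: Nmin; apply/asboolP; exists (p \o lift j); rewrite pE.
pose t := \sum_i mu i.
have t0 : 0 < t.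
  by rewrite /t (bigD1 k) //= ltr_wpDr // sumr_ge0.
have pj : p j = \sum_i (mu i / t) *: p (lift j i).
  apply: (scalerI (lt0r_neq0 t0)); rewrite scaler_sumr.
  under [RHS]eq_bigr => i _ do rewrite scalerA mulrC divfK ?gt_eqF //.
  apply/esym/subr0_eq; rewrite -[RHS]mus /t scaler_suml -sumrB.
  by apply: eq_big => i; rewrite ?inE // scalerBr.
apply/seteqP; split=> x [nu [nu0 _ nu1 ->]].
  exists (fun i => nu (lift j i) + nu j * (mu i / t)); split=> [i|i||].
  - by rewrite addr_ge0 // mulr_ge0 // divr_ge0 // ltW.
  - by rewrite inE.
  - rewrite big_split /= -mulr_sumr -mulr_suml divff ?gt_eqF // mulr1 -nu1.
    by rewrite [RHS](bigD1_ord j) //= addrC.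
  - rewrite (bigD1_ord j) //= pj scaler_sumr -big_split /=.
    by apply: eq_bigr => i _; rewrite scalerDl scalerA addrC.
exists (fun i => oapp nu 0 (unlift j i)); split=> [i|i||].
- by case: unlift.
- by rewrite inE.
- by rewrite (bigD1_ord j) //= unlift_none add0r -nu1; apply: eq_bigr => i _; rewrite liftK.
- rewrite (bigD1_ord j) //= unlift_none scale0r add0r.
  by apply: eq_bigr => i _; rewrite liftK.
Qed.

End Hull.

(** * Faces of a polytope as exposed sets of vertices *)

Lemma vspace_matrix (R : fieldType) n (U : {vspace 'rV[R]_n}) :
  exists2 M : 'M[R]_(\dim U, n), row_free M & forall y, (y \in U) = (y <= M)%MS.
Proof.
exists (\matrix_i (vbasis U)`_i).
  apply: inj_row_free => v; rewrite mulmx_sum_row => v0.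
  have /freeP := basis_free (vbasisP U) => /(_ (fun i => v 0 i)).
  by move=> H; apply/rowP => i; rewrite mxE H // -[RHS]v0; apply: eq_bigr => k _; rewrite rowK.
move=> y; apply/idP/idP => [/coord_vbasis ->|/submxP[D ->]].
  apply: summx_sub => i _; apply: scalemx_sub.
  by apply: (eq_row_sub i); rewrite rowK.
rewrite mulmx_sum_row rpred_sum // => i _; rewrite rpredZ // rowK.
by apply/vbasis_mem/mem_nth; rewrite size_tuple.
Qed.

Lemma matrix_vspace (R : fieldType) k n (M : 'M[R]_(k, n)) :
  exists2 U : {vspace 'rV[R]_n}, \dim U = \rank M & forall y, (y \in U) = (y <= M)%MS.
Proof.
pose X := [tuple row i (row_base M) | i < \rank M].
have XE (i : 'I_(\rank M)) : X`_i = row i (row_base M) by rewrite -tnth_nth tnth_mktuple.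
exists <<X>>%VS.
  have: free X.
    apply/freeP => c c0 i; have : \row_j c j = 0.
      apply: (row_free_inj (row_base_free M)); rewrite mul0mx mulmx_sum_row -[RHS]c0.
      by apply: eq_bigr => j _; rewrite mxE XE.
    by move/rowP/(_ i); rewrite !mxE.
  by rewrite /free => /eqP ->; rewrite size_tuple.
have yM y : (y <= M)%MS = (y <= row_base M)%MS by rewrite eq_row_base.
move=> y; rewrite yM; apply/idP/idP => [/coord_span ->|/submxP[D ->]].
  by apply: summx_sub => i _; rewrite XE scalemx_sub ?row_sub.
rewrite mulmx_sum_row rpred_sum // => i _; rewrite rpredZ // -XE.
by apply/memv_span/mem_nth; rewrite size_tuple.
Qed.

(** * Homogeneous coordinates *)

Section Homogenization.
Variables (R : realType) (n : nat).
Local Notation V := 'rV[R]_n.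

Definition homogenize (x : V) : 'rV[R]_(n + 1) := row_mx x 1%:M.
Definition height : 'cV[R]_(n + 1) := col_mx 0 1%:M.

Lemma dot_homogenize x (c : 'cV[R]_n) (k : 'cV[R]_1) :
  dot (homogenize x) (col_mx c k) = dot x c + k 0 0.
Proof. by rewrite /dot mul_row_col mul1mx mxE. Qed.

Lemma homogenize_height x : dot (homogenize x) height = 1.
Proof. by rewrite dot_homogenize dot0r add0r mxE eqxx. Qed.

Lemma homogenize_inj : injective homogenize.
Proof. by move=> x y /eq_row_mx[]. Qed.

Lemma homogenize_sum (I : finType) (mu : I -> R) (p : I -> V) : \sum_i mu i = 1 ->
  homogenize (\sum_i mu i *: p i) = \sum_i mu i *: homogenize (p i).
Proof.
move=> mu1; rewrite /homogenize.
under [RHS]eq_bigr => i _ do rewrite scale_row_mx.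
apply/rowP => j; rewrite summxE; have [k ->|k ->] := split_ordP j.
  by rewrite row_mxEl summxE; apply: eq_bigr => i _; rewrite row_mxEl.
rewrite row_mxEr ord1 mxE eqxx -[LHS]mu1; apply: eq_bigr => i _.
by rewrite row_mxEr !mxE eqxx mulr1.
Qed.

Lemma homogenizeB x y : homogenize x - homogenize y = row_mx (x - y) 0.
Proof. by rewrite /homogenize opp_row_mx add_row_mx subrr. Qed.

Definition functional_col (a : V -> R) : 'cV[R]_n := \col_j a (delta_mx 0 j).

Lemma dot_functional_col (a : {scalar V}) x : dot x (functional_col a) = a x.
Proof.
rewrite {2}[x]row_sum_delta linear_sum /dot mxE; apply: eq_bigr => j _.
by rewrite linearZ mxE.
Qed.

Definition dotr (c : 'cV[R]_n) (x : V) : R := dot x c.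

Fact dotr_is_scalar c : scalar (dotr c).
Proof. by move=> k x y; rewrite /dotr dotDl dotZl. Qed.

HB.instance Definition _ c :=
  GRing.isLinear.Build R V R *%R (dotr c) (dotr_is_scalar c).

End Homogenization.

Section PolytopeFaces.
Variables (R : realType) (n N : nat).
Local Notation V := 'rV[R]_n.
Variable p : 'I_N -> V.
Hypothesis p_exposed : forall j, exists c, forall i, i != j -> dot (p j) c < dot (p i) c.
Implicit Types (A B : {set 'I_N}) (F G : set V).

Local Notation P := (hull p [set: 'I_N]%SET).
Local Notation hp := (fun i => homogenize (p i)).
Local Notation e := (height R n).

Definition vertices_in F : {set 'I_N} := finset (fun i => `[< F (p i) >]).

Lemma vertices_inP F i : reflect (F (p i)) (i \in vertices_in F).
Proof. by rewrite inE; apply: asboolP. Qed.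

Lemma hp_height i : dot (hp i) e = 1. Proof. exact: homogenize_height. Qed.

Lemma hp_vertex i : exposed hp [set i]%SET.
Proof.
have [c cP] := p_exposed i.
exists (col_mx c (- (dot (p i) c)%:M)) => [j|].
  rewrite dot_homogenize !mxE eqxx subr_ge0.
  by have [->//|/cP/ltW] := eqVneq j i.
apply/setP => j; rewrite !inE dot_homogenize !mxE eqxx subr_eq0.
have [->|/cP ji] := eqVneq j i; first by rewrite eqxx.
by rewrite gt_eqF.
Qed.

Lemma hull_subset A B : A \subset B -> hull p A `<=` hull p B.
Proof.
move=> /fintype.subsetP AB x [mu [mu0 muA mu1 ->]]; exists mu; split=> // i iB.
by apply: muA; apply: contra iB => /AB.
Qed.

(** On the hull, [b - a x] is a sum of nonnegative terms [mu j * (b - a (p j))], so it vanishes only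
    if the weights are supported where [a] equals [b]. *)
Lemma hull_section A (a : V -> R) (b : R) : scalar a -> 
  (forall i, i \in A -> a (p i) <= b) ->
  hull p A `&` [set x | a x = b] = hull p (finset (fun i => (i \in A) && (a (p i) == b))).
Proof.
move=> sa ab.
have aE (mu : 'I_N -> R) : a (\sum_i mu i *: p i) = \sum_i mu i * a (p i).
  have a0 : a 0 = 0 by have := sa (-1) 0 0; rewrite scaler0 addr0 mulN1r addNr.
  elim/big_rec2: _ => [|i x y _ <-]; first exact: a0.
  exact: sa.
apply/seteqP; split=> x.
  move=> [[mu [mu0 muA mu1 xE]] axb]; exists mu; split=> // i.
  have ge0 j : 0 <= mu j * (b - a (p j)).
    have [/ab ajb|/muA ->] := boolP (j \in A); last by rewrite mul0r.
    by rewrite mulr_ge0 // subr_ge0.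
  have : \sum_j mu j * (b - a (p j)) == 0.
    under eq_bigr do rewrite mulrBr.
    by rewrite sumrB -mulr_suml mu1 mul1r -aE -xE axb subrr.
  rewrite psumr_eq0 // => /allP /(_ i (mem_index_enum i)) /=.
  rewrite inE mulf_eq0 subr_eq0 => /orP[/eqP->//|/eqP <-].
  by rewrite eqxx andbT => /muA.
move=> [mu [mu0 muA mu1 xE]]; split.
  exists mu; split=> // i iA; apply: muA; rewrite inE (negPf iA) //.
rewrite /= xE aE -[RHS]mul1r -mu1 mulr_suml; apply: eq_bigr => i _.
have [|/muA ->] := boolP (i \in (finset (fun i => (i \in A) && (a (p i) == b)))).
  by rewrite inE => /andP[_ /eqP ->].
by rewrite !mul0r.
Qed.

(** The inequality [a x <= b] is the nonnegativity of the functional [b - a] in homogeneous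
    coordinates. *)
Lemma face_hullP A G : exposed hp A ->
  face (hull p A) G <-> exists B, [/\ B \subset A, exposed hp B & G = hull p B].
Proof.
move=> eA; split.
  move=> [a [b [ab ->]]].
  have ab' i : i \in A -> a (p i) <= b by move=> iA; apply: ab; apply: mem_hull.
  rewrite (hull_section (linearP a) ab'); set B := finset _; exists B; split=> //.
    by apply/fintype.subsetP => i; rewrite inE => /andP[].
  have cE i : dot (hp i) (col_mx (- functional_col a) b%:M) = b - a (p i).
    by rewrite dot_homogenize dotNr dot_functional_col mxE eqxx addrC.
  apply: (exposedS eA (c := col_mx (- functional_col a) b%:M)) => [i iA|].
    by rewrite cE subr_ge0 ab'.
  by apply/setP => i; rewrite !inE cE subr_eq0 [b == _]eq_sym.
move=> [B [/fintype.subsetP BA [c c0 BE] ->]].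
pose a := dotr (- usubmx c); pose b := (dsubmx c) 0 0.
have cE i : dot (hp i) c = b - a (p i).
  by rewrite -[c]vsubmxK dot_homogenize addrC /a /b /dotr dotNr opprK.
have ab i : i \in A -> a (p i) <= b by move=> _; rewrite -subr_ge0 -cE.
have sa : scalar a by exact: dotr_is_scalar.
exists (dotr (- usubmx c)), b; split.
  move=> x [mu [mu0 muA mu1 ->]]; rewrite linear_sum -[leRHS]mul1r -mu1 mulr_suml.
  apply: ler_sum => i _; rewrite linearZ /= ler_wpM2l //.
  by have [iA|/muA mui] := boolP (i \in A); [apply: ab | move: (c0 i); rewrite cE subr_ge0].
rewrite (hull_section sa ab); congr hull; apply/setP => i; rewrite inE BE inE cE.
rewrite subr_eq0 eq_sym andbC; case: eqP => //= iB.
by apply/esym/BA; rewrite BE inE cE iB subrr.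
Qed.

Lemma vertices_in_hull A : exposed hp A -> vertices_in (hull p A) = A.
Proof.
move=> [c c0 AE]; apply/setP => i; apply/vertices_inP/idP; last exact: mem_hull.
move=> [mu [mu0 muA mu1 pE]]; rewrite AE inE.
rewrite pE homogenize_sum // dot_suml big1 // => j _; rewrite dotZl.
have [|/muA ->] := boolP (j \in A); last by rewrite mul0r.
by rewrite AE inE => /eqP ->; rewrite mulr0.
Qed.

Lemma faceP F : face P F <-> exposed hp (vertices_in F) /\ F = hull p (vertices_in F).
Proof.
split=> [/(face_hullP _ (exposed_setT _))[B [_ eB ->]]|[eF FE]].
  by rewrite vertices_in_hull.
apply/(face_hullP _ (exposed_setT _)); exists (vertices_in F).
by split=> //; apply: finset.subsetT.
Qed.

Lemma exposed_face A : exposed hp A -> face P (hull p A).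
Proof. by move=> eA; apply/faceP; rewrite vertices_in_hull. Qed.

Lemma hull_subsetP A B : exposed hp A -> exposed hp B ->
  hull p A `<=` hull p B <-> A \subset B.
Proof.
move=> eA eB; split; last exact: hull_subset.
move=> AB; apply/fintype.subsetP => i iA; rewrite -(vertices_in_hull eB).
by apply/vertices_inP/AB/mem_hull.
Qed.

Lemma hull_set1 i : hull p [set i]%SET = [set p i].
Proof.
apply/seteqP; split=> [x [mu [mu0 muA mu1 ->]]|x /= ->]; last by apply: mem_hull; rewrite inE.
have mui j : j != i -> mu j = 0 by move=> ji; apply: muA; rewrite inE.
have mu_i : mu i = 1.
  by rewrite -[RHS]mu1 (bigD1 i) //= big1 ?addr0.
by rewrite (bigD1 i) //= mu_i scale1r big1 ?addr0 // => j /mui ->; rewrite scale0r.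
Qed.

Lemma hull_set0 : hull p (finset.set0) = set0.
Proof.
apply/seteqP; split=> [x [mu [_ muA mu1 _]]|x //].
have := mu1; rewrite big1 => [/esym/eqP|i _]; first by rewrite oner_eq0.
by apply: muA; rewrite inE.
Qed.

Lemma exposed_set0 : exposed hp (finset.set0).
Proof.
exists e => [i|]; first by rewrite hp_height.
by apply/setP => i; rewrite !inE hp_height oner_eq0.
Qed.

Lemma vertexP v : vertex P v <-> exists i, v = p i.
Proof.
split=> [/faceP[_ vE]|[i ->]]; last first.
  by rewrite /vertex -hull_set1; apply/exposed_face/hp_vertex.
have [A0|/set0Pn[i /vertices_inP]] := eqVneq (vertices_in [set v]) (finset.set0).
  have : [set v] v by [].
  by rewrite vE A0 hull_set0.
by exists i.
Qed.

Lemma affine_hullE A : affine_hull (hull p A) =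
  [set y | (homogenize y <= span_of hp A)%MS].
Proof.
apply/seteqP; split=> y.
  move=> [k [c [z [zA c1 ->]]]]; rewrite /= homogenize_sum //.
  apply: summx_sub => i _; apply: scalemx_sub; have [mu [mu0 muA mu1 ->]] := zA i.
  rewrite homogenize_sum //; apply: summx_sub => j _.
  have [jA|/muA ->] := boolP (j \in A); last by rewrite scale0r sub0mx.
  by rewrite scalemx_sub ?mem_span.
move=> /= yA; have [A0|/set0Pn[i0 i0A]] := eqVneq A (finset.set0).
  exfalso; move: yA; rewrite /span_of A0 big_set0 submx0 => /eqP y0.
  have := homogenize_height y; rewrite y0 dot0l => /esym/eqP.
  by rewrite oner_eq0.
have [mu yE] := span_coef yA.
have yE' : homogenize y = \sum_i (if i \in A then mu i else 0) *: homogenize (p i).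
  by rewrite yE big_mkcond; apply: eq_bigr => i _; case: ifP => //; rewrite scale0r.
have mu1 : \sum_i (if i \in A then mu i else 0) = 1.
  have := congr1 (fun x => dot x e) yE'; rewrite homogenize_height dot_suml => ->.
  by apply: eq_bigr => i _; rewrite dotZl homogenize_height mulr1.
(* All points of the combination must lie in the hull, so indices outside [A], of weight zero, get
   the dummy [p i0]. *)
exists N, (fun i => if i \in A then mu i else 0), (fun i => if i \in A then p i else p i0).
split=> //; first by move=> i; case: ifP => iA; apply: mem_hull.
apply: homogenize_inj; rewrite yE' -homogenize_sum //; congr homogenize.
by apply: eq_bigr => i _; case: ifP => //; rewrite !scale0r.
Qed.

(** The span is the direction space [M] at height zero plus the line through [homogenize x]. *)
Lemma rk_direction A k (M : 'M[R]_(k, n)) x : (homogenize x <= span_of hp A)%MS ->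
  (forall y, (homogenize y <= span_of hp A)%MS = (y - x <= M)%MS) ->
  rk hp A = (\rank M).+1.
Proof.
move=> xA MA; apply/eqP; rewrite eqn_leq; apply/andP; split.
  have sub : (span_of hp A <= row_mx M 0 + homogenize x)%MS.
    apply: span_subP => i /(mem_span hp); rewrite MA => piM.
    rewrite -[homogenize (p i)](subrK (homogenize x)) addmx_sub_adds //.
    rewrite homogenizeB; case/submxP: piM => D ->.
    rewrite -[X in row_mx _ X](mulmx0 _ D) -mul_mx_row; exact: submxMl.
  apply: leq_trans (mxrankS sub) _.
  apply: leq_trans (leq_of_leqif (mxrank_adds_leqif _ _)) _.
  by rewrite rank_row_mx0 -[X in (_ <= X)%N]addn1 leq_add2l rank_leq_row.
rewrite -(rank_row_mx0 1 M); apply: (mxrank_lt_functional (c := e) (x := homogenize x)) => //.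
- apply/row_subP => i; rewrite row_row_mx row0.
  have -> : row_mx (row i M) 0 = homogenize (x + row i M) - homogenize x.
    by rewrite homogenizeB addrC addKr.
  by rewrite addmx_sub ?eqmx_opp // MA addrC addKr row_sub.
- by rewrite mul_row_col mulmx0 mul0mx addr0.
- by rewrite homogenize_height oner_neq0.
Qed.

Lemma has_dimP A k : (exists i, i \in A) -> has_dim (hull p A) k <-> rk hp A = k.+1.
Proof.
move=> [i0 i0A]; rewrite /has_dim affine_hullE; split.
  move=> [x [U [/seteqP[sub1 sub2] <-]]]; have [M freeM UM] := vspace_matrix U.
  rewrite (@rk_direction A _ M x); first by move/eqP: freeM => ->.
    by apply: sub2; rewrite /= subrr mem0v.
  by move=> y; rewrite -UM; apply/idP/idP => [/sub1|/sub2].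
move=> rA; pose M : 'M[R]_(N, n) := \matrix_i (if i \in A then p i - p i0 else 0).
have MA y : (homogenize y <= span_of hp A)%MS = (y - p i0 <= M)%MS.
  apply/idP/idP => [/span_coef[mu yE]|/submxP[D yE]].
    have -> : y - p i0 = \sum_(i in A) mu i *: (p i - p i0).
      have mu1 : \sum_(i in A) mu i = 1.
        have := congr1 (fun x => dot x e) yE; rewrite homogenize_height dot_suml => ->.
        by apply: eq_bigr => i _; rewrite dotZl homogenize_height mulr1.
      apply: (@homogenize_inj R n).
      apply/eqP; rewrite -subr_eq0 homogenizeB.
      have -> : row_mx (y - p i0 - \sum_(i in A) mu i *: (p i - p i0)) (0 : 'M_1) = 0.
        rewrite (_ : _ - _ = 0) ?row_mx0 //.
        have := congr1 lsubmx yE; rewrite row_mxKl => ->.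
        under [X in _ - X]eq_bigr do rewrite scalerBr.
        rewrite sumrB -scaler_suml mu1 scale1r linear_sum.
        under eq_bigr do rewrite linearZ /= row_mxKl.
        by rewrite subrr.
      by rewrite eqxx.
    apply: summx_sub => i iA; apply: scalemx_sub.
    by apply: (eq_row_sub i); rewrite rowK iA.
  rewrite -[homogenize y](subrK (homogenize (p i0))) addmx_sub ?mem_span //.
  rewrite homogenizeB yE -[X in row_mx _ X](mulmx0 _ D) -mul_mx_row.
  apply: submx_trans (submxMl _ _) _; apply/row_subP => i; rewrite row_row_mx row0 rowK.
  case: ifP => iA; last by rewrite row_mx0 sub0mx.
  by rewrite -homogenizeB addmx_sub ?eqmx_opp ?mem_span.
have [U dimU UM] := matrix_vspace M; exists (p i0), U; split.
  by apply/seteqP; split=> y /=; rewrite MA UM.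
by have := rk_direction (mem_span hp i0A) MA; rewrite rA dimU => -[].
Qed.

Lemma vertices_inj : injective p.
Proof. by move=> i j pij; apply: (point_inj hp_vertex); rewrite pij. Qed.

(** An edge has rank 2 and contains a neighbour [k] of [i]. The exposed pair of [i] and [k] already
    has that rank, so it exhausts the edge and [j = k]. *)
Lemma adjP i j : adj (polytope_graph P) (p i) (p j) <-> adj_in hp i j.
Proof.
split.
  move=> [_ _ pij [E [[/faceP[eE EE] dimE] Ei Ej]]].
  have [/vertices_inP iE /vertices_inP jE] := (Ei, Ej).
  have ij : i != j by apply: contra_not_neq pij => ->.
  have rE : rk hp (vertices_in E) = 2%N.
    by apply/has_dimP; [exists i | rewrite -EE].
  have ji : j != i by rewrite eq_sym.
  have [k kE ik] := nbr_in_face hp_height hp_vertex eE iE jE ji.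
  suff -> : j = k by [].
  have /andP[nik /asboolP eik] := ik.
  have : [set i; k]%SET == vertices_in E.
    rewrite eqEproper; apply/andP; split.
      by apply/fintype.subsetP => x; rewrite in_set2 => /orP[] /eqP ->.
    apply/negP => /(exposed_rk_proper eik); rewrite rE ltnS leqNgt => /negP; apply.
    apply: leq_ltn_trans (rk_gt0 hp_height (finset.set11 i)) _.
    apply: exposed_rk_proper; first exact: hp_vertex.
    apply/properP; split; first exact: finset.subsetUl.
    by exists k; rewrite !inE ?eqxx ?orbT // eq_sym.
  by move/eqP/setP/(_ j); rewrite jE !inE (negPf ji) => /eqP.
move=> /andP[ij /asboolP eij]; split; try by apply/vertexP; eexists.
  by move=> /vertices_inj E; rewrite E eqxx in ij.
exists (hull p [set i; j]%SET); split; try by apply: mem_hull; rewrite !inE eqxx ?orbT.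
split; first exact: exposed_face.
apply/has_dimP; first by exists i; rewrite !inE eqxx.
apply/eqP; rewrite eqn_leq; apply/andP; split.
  by apply: leq_trans (rk_card _ _) _; rewrite cards2; case: (_ != _).
apply: leq_ltn_trans (rk_gt0 hp_height (finset.set11 i)) _.
apply: exposed_rk_proper; first exact: hp_vertex.
apply/properP; split; first exact: finset.subsetUl.
by exists j; rewrite !inE ?eqxx ?orbT // eq_sym.
Qed.

End PolytopeFaces.

(** * Faces of the standard cube *)

Section StandardCube.
Variables (R : realType) (k : nat).
Local Notation Q := (@standard_cube R k).
Implicit Types (w t : {ffun 'I_k -> bool}).

Definition cube_point w : 'rV[R]_k := \row_j (w j)%:R.

Lemma cube_point_inj : injective cube_point.
Proof.
move=> w t /rowP wt; apply/ffunP => j; have := wt j; rewrite !mxE => /eqP.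
by rewrite eqr_nat; case: (w j); case: (t j).
Qed.

Lemma cube_point_in w : Q (cube_point w).
Proof. by move=> j; rewrite mxE; case: (w j); rewrite ?lexx ?ler01. Qed.

Definition subcube w (J : {set 'I_k}) : set 'rV[R]_k :=
  [set x | Q x /\ forall j, j \in J -> x 0 j = (w j)%:R].

Lemma subcube_face w J : face Q (subcube w J).
Proof.
(* On the cube, the defect [b - dotr c x] is the sum over [J] of the distances between the
   coordinates of [x] and [w]. *)
pose c : 'cV[R]_k := \col_j (if j \in J then (if w j then 1 else -1) else 0).
pose b : R := \sum_(j in J) (w j)%:R.
have defect x : b - dotr c x = \sum_(j in J) `|(w j)%:R - x 0 j| + 
    \sum_(j in J) ((w j)%:R - (if w j then 1 else -1) * x 0 j - `|(w j)%:R - x 0 j|).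
  rewrite -big_split /= /b /dotr /dot mxE [X in _ - X](bigID (mem J)) /=.
  rewrite [X in _ - (_ + X)]big1 ?addr0 => [|j /negPf jJ]; last by rewrite mxE jJ mulr0.
  rewrite -sumrB; apply: eq_bigr => j jJ; rewrite mxE jJ addrC subrK mulrC; by [].
have {}defect x : Q x -> b - dotr c x = \sum_(j in J) `|(w j)%:R - x 0 j|.
  move=> Qx; rewrite defect [X in _ + X]big1 ?addr0 // => j _.
  have /andP[x0 x1] := Qx j; case: (w j).
    by rewrite mul1r ger0_norm ?subrr // subr_ge0.
  by rewrite mulN1r opprK !sub0r add0r normrN ger0_norm ?subrr.
exists (dotr c), b; split.
  by move=> x Qx; rewrite -subr_ge0 defect // sumr_ge0.
apply/seteqP; split=> x [Qx].
  move=> xw; split=> //; apply/esym/subr0_eq; rewrite defect // big1 // => j jJ.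
  by rewrite xw // subrr normr0.
move=> /= xb; split=> // j jJ; have := defect x Qx; rewrite xb subrr => /esym/eqP.
rewrite psumr_eq0 // => /allP /(_ j (mem_index_enum j)).
by rewrite jJ normr_eq0 subr_eq0 => /eqP.
Qed.

Lemma subcube_point w : subcube w [set: 'I_k]%SET = [set cube_point w].
Proof.
apply/seteqP; split=> x; last first.
  by move=> ->; split=> [|j _]; [apply: cube_point_in | rewrite mxE].
by move=> [_ xw]; apply/rowP => j; rewrite mxE xw ?inE.
Qed.

(** [alpha] lists the coefficients of the functional exposing [G]. Its terms are maximised
    independently over the cube, and a zero coefficient imposes no condition. *)
Lemma cube_face_vertices G : face Q G -> G !=set0 ->
  exists alpha : 'I_k -> R, forall t, G (cube_point t) <->
    forall j, (0 < alpha j -> t j) /\ (alpha j < 0 -> ~~ t j).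
Proof.
move=> [a [b [ab ->]]] [x [Qx axb]]; pose al j := a (delta_mx 0 j).
have aE y : a y = \sum_j y 0 j * al j.
  rewrite [in LHS](row_sum_delta y) linear_sum; apply: eq_bigr => j _.
  by rewrite linearZ.
pose w0 : {ffun 'I_k -> bool} := [ffun j => 0 < al j].
have term_le (y : R) j : 0 <= y <= 1 -> y * al j <= (w0 j)%:R * al j.
  rewrite ffunE => /andP[y0 y1]; have [al0|al0] := ltP 0 (al j).
    by rewrite ler_wpM2r // ltW.
  by rewrite mul0r mulr_ge0_le0.
(* As [G] is nonempty, [b] is the maximum over the cube, attained at the vertex [w0]. *)
have bE : b = \sum_j (w0 j)%:R * al j.
  apply/eqP; rewrite eq_le; apply/andP; split.
    by rewrite -axb aE ler_sum // => j _; apply: term_le (Qx j).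
  have := ab _ (cube_point_in w0); rewrite aE.
  by under eq_bigr do rewrite mxE.
exists al => t; have atE : b - a (cube_point t) = \sum_j ((w0 j)%:R - (t j)%:R) * al j.
  rewrite bE aE -sumrB; apply: eq_bigr => j _; by rewrite mxE mulrBl.
have ge0 j : 0 <= ((w0 j)%:R - (t j)%:R) * al j.
  by rewrite mulrBl subr_ge0 term_le //; case: (t j); rewrite ?lexx ?ler01.
split.
  move=> [_ /= atb] j; move/eqP: atE; rewrite atb subrr eq_sym psumr_eq0 //.
  move=> /allP /(_ j (mem_index_enum j)); rewrite /= ffunE mulf_eq0.
  have [al0|al0|al0] := ltgtP 0 (al j); rewrite ?orbF.
  - by rewrite subr_eq0 eqr_nat; case: (t j).
  - by rewrite subr_eq0 eqr_nat; case: (t j).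
  - by [].
move=> H; split; first exact: cube_point_in.
apply/esym/subr0_eq; rewrite atE big1 // => j _; have [H1 H2] := H j; rewrite ffunE.
have [al0|al0|<-] := ltgtP 0 (al j); last by rewrite mulr0.
- by rewrite H1 // subrr mul0r.
- by rewrite (negPf (H2 al0)) subrr mul0r.
Qed.

End StandardCube.

(** * Boolean coordinates on the vertices of a cube *)

Section CubeFacets.
Variables (R : realType) (n N : nat) (p : 'I_N -> 'rV[R]_n).
Hypothesis p_exposed : forall j, exists c, forall i, i != j -> dot (p j) c < dot (p i) c.
Local Notation P := (hull p [set: 'I_N]%SET).
Local Notation hp := (fun i => homogenize (p i)).

Implicit Types (A B C : {set 'I_N}).

(** The lattice isomorphism takes vertices to vertices, which defines [phi]; membership of a vertex
    in a face is an inclusion of faces and so is preserved. *)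
Lemma cube_hull A : exposed hp A -> cube (hull p A) -> cube_like hp A.
Proof.
move=> eA [_ [k [f [[f_fun f_inj f_surj] f_mono]]]].
have faceA B : B \subset A -> exposed hp B -> face (hull p A) (hull p B).
  by move=> BA eB; apply/(face_hullP _ eA); exists B.
have face_f B : B \subset A -> exposed hp B -> face (@standard_cube R k) (f (hull p B)).
  by move=> BA eB; apply: f_fun; apply: faceA.
have preimage G : face (@standard_cube R k) G ->
    exists B, [/\ B \subset A, exposed hp B & f (hull p B) = G].
  by case/f_surj => F /(face_hullP _ eA)[B [BA eB ->]] <-; exists B.
have mono B C : B \subset A -> exposed hp B -> C \subset A -> exposed hp C ->
    (f (hull p B) `<=` f (hull p C)) <-> (B \subset C).
  move=> BA eB CA eC; rewrite -(hull_subsetP eB eC).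
  by apply: iff_sym; apply: f_mono; apply: faceA.
have f0 : f (hull p finset.set0) = set0.
  have [B [BA eB fB]] : exists B, [/\ B \subset A, exposed hp B & f (hull p B) = set0].
    apply: preimage; exists (dotr 0), 1; split=> [x _|]; first by rewrite /= /dotr dot0r ler01.
    by apply/seteqP; split=> x // [_ /= /eqP]; rewrite /= /dotr dot0r eq_sym oner_eq0.
  apply/seteqP; split=> //; rewrite -fB.
  by apply/mono; rewrite ?finset.sub0set //; apply: exposed_set0.
have set1A i : i \in A -> [set i]%SET \subset A by rewrite finset.sub1set.
have eset1 i : exposed hp [set i]%SET by apply: hp_vertex.
have fne B i : i \in B -> B \subset A -> exposed hp B -> f (hull p B) !=set0.
  move=> iB BA eB; apply/set0P; apply/eqP => fB0.
  have : f (hull p B) `<=` f (hull p finset.set0) by rewrite fB0.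
  move/mono; rewrite finset.sub0set => /(_ BA eB isT (exposed_set0 _)) /fintype.subsetP/(_ i iB).
  by rewrite inE.
have atom i : i \in A -> exists w, f (hull p [set i]%SET) = [set cube_point R w].
  move=> iA; have fi := face_f _ (set1A i iA) (eset1 i).
  have ne := fne [set i]%SET i (finset.set11 i) (set1A i iA) (eset1 i).
  have [al alP] := cube_face_vertices fi ne.
  pose w : {ffun 'I_k -> bool} := [ffun j => 0 < al j].
  (* The image of a vertex contains a cube point, whose preimage is a nonempty face inside that
     single vertex, hence equal to it. *)
  have wG : f (hull p [set i]%SET) (cube_point R w).
    by apply/alP => j; rewrite ffunE; split=> //; rewrite -leNgt => /ltW.
  have [B [BA eB fB]] := preimage _ (subcube_face R w [set: 'I_k]%SET).
  rewrite subcube_point in fB.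
  exists w; rewrite -fB; congr (f (hull p _)); apply/eqP.
  rewrite eq_sym finset.eqEsubset; apply/andP; split.
    by apply/mono; rewrite ?set1A // fB => _ ->.
  rewrite finset.sub1set; apply/negPn/negP => iB.
  have B0 : B = finset.set0.
    apply/setP => j; rewrite inE; apply/negP => jB.
    have /mono : f (hull p B) `<=` f (hull p [set i]%SET) by rewrite fB => _ ->.
    move=> /(_ BA eB (set1A i iA) (eset1 i)) /fintype.subsetP /(_ j jB).
    by rewrite inE => /eqP ji; rewrite ji in jB; rewrite jB in iB.
  have : [set cube_point R w] (cube_point R w) by [].
  by rewrite -fB B0 f0.
have /choice[phi phiP] : forall i, exists w,
    i \in A -> f (hull p [set i]%SET) = [set cube_point R w].
  move=> i; have [/atom[w ?]|_] := boolP (i \in A); first by exists w.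
  by exists [ffun=> false].
have memP B i : B \subset A -> exposed hp B -> i \in A ->
    f (hull p B) (cube_point R (phi i)) <-> i \in B.
  move=> BA eB iA; rewrite -finset.sub1set; split=> [fBi|/mono].
    by apply/mono => //; [exact: set1A | rewrite phiP // => _ ->].
  by rewrite phiP // => /(_ (set1A i iA) (eset1 i) BA eB); apply.
exists k, phi; split.
- move=> i j iA jA phiij; have : f (hull p [set i]%SET) (cube_point R (phi j)).
    by rewrite phiP // phiij.
  by move/memP => /(_ (set1A i iA) (eset1 i) jA); rewrite inE => /eqP.
- move=> w; have [B [BA eB fB]] := preimage _ (subcube_face R w [set: 'I_k]%SET).
  rewrite subcube_point in fB.
  have [B0|/set0Pn[i iB]] := eqVneq B finset.set0.
    have : [set cube_point R w] (cube_point R w) by [].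
    by rewrite -fB B0 f0.
  have iA := fintype.subsetP BA i iB; exists i => //.
  by have /memP := iB => /(_ BA eB iA); rewrite fB => /cube_point_inj.
- move=> B t eB BA /set0Pn[b0 b0B] tA tB.
  have [al alP] := cube_face_vertices (face_f B BA eB) (fne B b0 b0B BA eB).
  (* [t] violates the sign condition of the face in some coordinate; the vertices of [B] satisfy it,
     so they differ from [t] there. *)
  have : ~ f (hull p B) (cube_point R (phi t)) by rewrite memP //; apply/negP.
  rewrite alP => /existsNP[j jP]; exists j => b bB.
  have bA := fintype.subsetP BA b bB.
  have := bB; rewrite -(memP B b BA eB bA) alP => /(_ j) [H1 H2].
  apply: contra_not_neq jP => <-; split; [exact: H1 | exact: H2].
- move=> w J; have [B [BA eB fB]] := preimage _ (subcube_face R w J).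
  suff -> : [set l in A | [forall j in J, phi l j == w j]]%SET = B by [].
  apply/setP => l; rewrite inE; apply/andP/idP.
    move=> [lA /forall_inP lw]; apply/memP => //; rewrite fB.
    split; first exact: cube_point_in.
    by move=> j jJ; rewrite mxE (eqP (lw j jJ)).
  move=> lB; have lA := fintype.subsetP BA l lB; split=> //; apply/forall_inP => j jJ.
  have := lB; rewrite -(memP B l BA eB lA) fB => -[_ /(_ j jJ)].
  by rewrite mxE => /eqP; rewrite eqr_nat; case: (phi l j); case: (w j).
Qed.

End CubeFacets.

(** The rank bounds the dimension [k] by two, and a smaller cube has too few vertices for rank 3. *)
Lemma cube_card3 (R : realFieldType) m (I : finType) (p : I -> 'rV[R]_m) (e : 'cV[R]_m)
    (A : {set I}) : (forall i, dot (p i) e = 1) ->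
  cube_like p A -> rk p A = 3%N -> #|A| = 4%N.
Proof.
move=> pe [k [phi [inj surj _ sub]]] rA.
have k2 : (k <= 2)%N by rewrite -ltnS -rA (cube_dim_le pe surj sub).
have AE : #|A| = (2 ^ k)%N.
  rewrite -(card_in_imset inj) (_ : phi @: A = [set: {ffun 'I_k -> bool}]%SET).
    by rewrite cardsT card_ffun card_bool card_ord.
  by apply/setP => w; rewrite inE; have [i iA <-] := surj w; rewrite imset_f.
have := rk_card p A; rewrite rA AE.
by move: k2; case: k {phi inj surj sub AE} => [|[|[|k]]].
Qed.

(** * From the vertex configuration back to the graph of the polytope *)

Lemma card_image_finset (I : finType) (T : Type) (p : I -> T) (A : {set I}) :
  injective p -> [set x | exists2 i, i \in A & x = p i] #= `I_#|A|.
Proof.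
move=> pinj; rewrite card_eq_sym.
case: (pickP (mem A)) => [i0 _|A0]; last first.
  have -> : #|A| = 0%N by apply: eq_card0.
  rewrite II0 (_ : [set x | _] = set0) ?card_eqxx //.
  by apply/seteqP; split=> x // [i iA _]; have := A0 i; rewrite /= iA.
pose f k := p (nth i0 (enum A) k).
suff : set_bij `I_#|A| [set x | exists2 i, i \in A & x = p i] f.
  by move=> /Pbij[g _]; apply: (pcard_eq g).
split.
- by move=> k /= kA; exists (nth i0 (enum A) k) => //; rewrite -mem_enum mem_nth // -cardE.
- move=> k l; rewrite !inE /= => kA lA /pinj/eqP; rewrite nth_uniq -?cardE ?enum_uniq //.
  by move/eqP.
- move=> x [i iA ->]; exists (index i (enum A)); last by rewrite /f nth_index // mem_enum.
  by rewrite /= cardE index_mem mem_enum.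
Qed.

Theorem corollary20 (R : realType) (n d : nat) (P : set 'rV[R]_n)
  (cubP : cubical_polytope d P)
  (nosimple : forall v : 'rV[R]_n, ~ simple_vertex d P v) :
  k_connected d.+1 (polytope_graph P).
Proof.
case: cubP => /polytope_vertices[N [p [PE pexp]]] dimP cubF.
rewrite {}PE in dimP cubF nosimple *.
pose hp i := homogenize (p i).
have pe i : dot (hp i) (height R n) = 1 by exact: homogenize_height.
have vtx : forall i, exposed hp [set i]%SET := hp_vertex pexp.
(* There is a vertex, because the affine hull of a set that has a dimension contains a point. *)
have [i0 _] : exists i, i \in [set: 'I_N]%SET.
  case: N p pexp dimP {cubF nosimple hp pe vtx} => [|N] p _ dimP; last by exists ord0; rewrite inE.
  have [x [U [/seteqP[_ sub] _]]] := dimP.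
  have : affine_hull (hull p [set: 'I_0]%SET) x by apply: sub; rewrite /= subrr mem0v.
  rewrite affine_hullE /= (_ : [set: 'I_0]%SET = finset.set0); last by apply/setP => -[].
  rewrite /span_of big_set0 submx0 => /eqP x0.
  have := homogenize_height x; rewrite x0 dot0l => /esym/eqP.
  by rewrite oner_eq0.
have rkT : rk hp [set: 'I_N]%SET = d.+1.
  by apply/has_dimP => //; exists i0; rewrite inE.
have degree i : #|nbrs hp i| <> d.
  move=> deg; apply: (nosimple (p i)); split; first by apply/vertexP => //; exists i.
  rewrite /degree_eq -deg (_ : [set w | _] = [set x | exists2 j, j \in nbrs hp i & x = p j]).
    exact/card_image_finset/(vertices_inj pexp).
  apply/seteqP; split=> [x [/(vertexP pexp)[j ->] /(adjP pexp) ij]|x [j ij ->]].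
    by exists j; rewrite // inE.
  split; first by apply/(vertexP pexp); exists j.
  by apply/(adjP pexp); rewrite inE in ij.
(* Rank [d] is dimension [d - 1]; the condition [0 < d] excludes the empty set. *)
have facet_cube A : exposed hp A -> rk hp A = d -> (0 < d)%N -> cube_like hp A.
  move=> eA rA d0; apply: cube_hull => //; apply: cubF; split; first exact: exposed_face.
  have [A0|/set0Pn[i iA]] := eqVneq A finset.set0.
    by move: rA (rk_card hp A); rewrite A0 cards0 => ->; rewrite leqNgt d0.
  exists d.-1; last exact: prednK.
  by apply/has_dimP; [exists i | rewrite prednK].
have [d2|d3] := leqP d 2.
  by have := low_dimension_nbrs pe vtx i0 rkT d2 => /degree.
have [g ginj] := generic_functional (point_inj vtx).
have {}d3 : (3 < d)%N.
  rewrite ltn_neqAle d3 andbT; apply/eqP => dE; subst d.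
  have [A /facetsP[eA rA]|i /degree //] := dimension3_nbrs pe vtx rkT ginj.
  by apply: (cube_card3 pe) => //; apply: facet_cube.
have vE : verts (polytope_graph (hull p [set: 'I_N]%SET)) =
    [set x | exists2 i, i \in [set: 'I_N]%SET & x = p i].
  apply/seteqP; split=> [x /(vertexP pexp)[i ->]|x [i _ ->]].
    by exists i; rewrite ?inE.
  by apply/(vertexP pexp); exists i.
split.
  (* The vertex [i0] and its neighbours, more than [d] in number, are at least [d + 2] vertices. *)
  rewrite vE (card_le_eqr (card_image_finset _ (vertices_inj pexp))) card_le_II cardsT card_ord.
  have : (d < #|nbrs hp i0|)%N.
    by rewrite ltn_neqAle (nbrs_card_ge pe vtx rkT) andbT eq_sym; apply/eqP.
  have : (#|nbrs hp i0| <= #|[set~ i0]%SET|)%N.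
    by apply/subset_leq_card/fintype.subsetP => j; rewrite !inE /adj_in eq_sym => /andP[].
  rewrite cardsC1 card_ord => le1 lt1; have := leq_trans lt1 le1; clear; lia.
move=> S k SV Sk kd u v [uV uS] [vV vS].
pose S0 := vertices_in p S.
have SE : S = [set x | exists2 i, i \in S0 & x = p i].
  apply/seteqP; split=> [x xS|x [i /vertices_inP iS ->] //].
  have /(vertexP pexp)[i xi] := SV x xS; exists i => //.
  by apply/vertices_inP; rewrite -xi.
have cS0 : (#|S0| <= d)%N.
  have : `I_k #= `I_#|S0|.
    rewrite -(card_eql Sk) {1}SE; exact: card_image_finset (vertices_inj pexp).
  by move/card_eq_II => <-.
move: uV vV => /(vertexP pexp)[i ui] /(vertexP pexp)[j vj]; subst u v.
have iS : i \notin S0 by apply/negP => /vertices_inP.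
have jS : j \notin S0 by apply/negP => /vertices_inP.
have : connect (adj_within hp (~: S0)%SET) i j.
  apply: contrapT => /negP ij.
  have [|w /degree //] := separator_simple pe vtx rkT _ d3 cS0 iS jS ij.
  by move=> A eA rA; apply: facet_cube => //; apply: leq_trans d3.
move=> /connectP[s sP ->]; exists (map p s); split; last by rewrite last_map.
  elim: s i sP {iS uS} => //= x s IH i /andP[/and3P[ix _ _] sP].
  by rewrite IH // andbT; apply/asboolP/(adjP pexp).
elim: s i sP {iS uS} => //= x s IH i /andP[/and3P[_ _ xS] sP] y.
rewrite inE => /orP[/eqP ->|]; last exact: IH sP y.
split; first by apply/(vertexP pexp); exists x.
by move=> Spx; move: xS; rewrite finset.in_setC => /vertices_inP.
Qed.
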